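(* Let $T$ be a nonexpansive linear operator on a separable Hilbert space and let $f$ be an element of that space. Let $f^*=\lim_nA_nf$. Then $f^*$, and a bound on the rate of convergence of $(A_nf)$ in the Hilbert space norm, can be computed from $f$, $T$, and $\|f^*\|$.
   Context: $T$ is nonexpansive if $\|Tf\|\le\|f\|$ for all $f$; $A_nf=\frac1n\sum_{0\le i<n}T^if$ for $n\ge1$ (the limit $f^*$ exists by the mean ergodic theorem). A bound on the rate of convergence of $(A_nf)$ is a function $r$ from positive rationals to positive integers such that $\|A_mf-A_{r(\varepsilon)}f\|<\varepsilon$ for all rational $\varepsilon>0$ and all $m\ge r(\varepsilon)$. Computability conventions (standard computable analysis). A representation of a real number is a sequence of rationals converging to it together with a bound on the rate of convergence. A separable Hilbert space is assumed to come with a fixed choice of basis, such that the inner product and norm are computable operations; an element is represented by a sequence of finite linear combinations of basis elements (with rational, or over $\mathbb{C}$ Gaussian rational, coefficients) converging to it in norm, together with a bound on the rate of convergence; a bounded linear operator is represented by (representations of) the sequence of its values on the basis elements. An object ''can be computed from'' given data if there is an algorithm which, given oracle access to any representations of the data, computes a representation of the object. *)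

(* Defs.v *)
From HB Require Import structures.
From mathcomp Require Import all_boot all_order all_algebra.
From mathcomp Require Import complex.
From mathcomp Require Import all_classical all_reals all_analysis.

Set Implicit Arguments.
Unset Strict Implicit.
Unset Printing Implicit Defensive.

Import Order.TTheory GRing.Theory Num.Theory.
Import numFieldNormedType.Exports.

Local Open Scope classical_set_scope.
Local Open Scope ring_scope.

(** * Oracle computability

    First-order recursive programs over the natural numbers (McCarthy's
    formalism, equivalent to Turing machines), extended with oracle calls.
    A program is a list of mutually recursive function bodies; function 0 is
    the entry point. A function takes a tuple of arguments of any length, and
    reading a missing argument yields 0. *)

(** Names are the objects oracles provide and programs compute: total functions
    from finite tuples of natural numbers to natural numbers. *)
Definition name : Type := seq nat -> nat.

Inductive expr : Type :=
| Var of nat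
| Zero
| Succ of expr
| Pred of expr
| Ifz of expr & expr & expr
| Call of nat & seq expr
| Ask of nat & seq expr.

Definition program : Type := seq expr.

Fixpoint all_some (s : seq (option nat)) : option (seq nat) :=
  match s with
  | [::] => Some [::]
  | Some v :: s' => omap (cons v) (all_some s')
  | None :: _ => None
  end.

(** [run P O fuel env t] is [Some v] if [t] evaluates (call by value) to [v] by
    an evaluation of depth less than [fuel], and [None] otherwise; [O] lists the
    oracles. *)
Fixpoint run (P : program) (O : seq name) (fuel : nat) (env : seq nat)
    (t : expr) : option nat :=
  if fuel is fuel'.+1 then
    let ev := run P O fuel' in
    match t with
    | Var i => Some (nth 0%N env i)
    | Zero => Some 0%N
    | Succ t1 => omap succn (ev env t1)
    | Pred t1 => omap predn (ev env t1)
    | Ifz t1 t2 t3 =>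
        obind (fun v => ev env (if v == 0%N then t2 else t3)) (ev env t1)
    | Call g ts =>
        obind (fun vs => obind (ev vs) (onth P g)) (all_some (map (ev env) ts))
    | Ask o ts =>
        omap (nth (fun _ => 0%N) O o) (all_some (map (ev env) ts))
    end
  else None.

Definition computes (P : program) (O : seq name) (psi : name) : Prop :=
  forall q : seq nat, exists fuel : nat,
    obind (run P O fuel q) (onth P 0) = Some (psi q).

Definition computes_some (P : program) (O : seq name) (N : name -> Prop) : Prop :=
  exists psi : name, computes P O psi /\ N psi.

(** * Scalars *)

Variant scalar_kind : Set := RealScalars | ComplexScalars.

Definition scalars (R : realType) (k : scalar_kind) : numFieldType :=
  match k with
  | RealScalars => R
  | ComplexScalars => R[i]
  end.

Definition conj_scalar (R : realType) (k : scalar_kind) :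
    scalars R k -> scalars R k :=
  match k return scalars R k -> scalars R k with
  | RealScalars => idfun
  | ComplexScalars => @conjc R
  end.

(** [a] over the reals (where [b] is ignored), and [a + i b] over the complex
    numbers. *)
Definition rat_scalar (R : realType) (k : scalar_kind) (a b : rat) : scalars R k :=
  match k return scalars R k with
  | RealScalars => ratr a : R
  | ComplexScalars => Complex (ratr a : R) (ratr b : R)
  end.

Arguments conj_scalar {R k}.
Arguments rat_scalar {R} k.

(** * Rates of convergence and representations

    Norms take their values in the scalar field [K], as is the convention of the
    library; over the complex numbers [ratr eps : K] is a real number and [<] is
    the order of the reals. *)

Definition rate_bound (K : numFieldType) (V : normedModType K)
    (u : nat -> V) (r : rat -> nat) : Prop :=
  forall eps : rat, 0 < eps ->
    (0 < r eps)%N /\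
    forall m : nat, (r eps <= m)%N -> `|u m - u (r eps)| < ratr eps.

Definition subname (phi : name) (t : nat) : name := fun q => phi (t :: q).

(** The positive rational (a+1)/(b+1) is passed to a rate as the pair (a, b). A
    rate is a function of the rational number, hence the value may not depend on
    the fraction chosen. *)
Definition names_rate (K : numFieldType) (V : normedModType K)
    (u : nat -> V) (phi : name) : Prop :=
  exists r : rat -> nat, rate_bound u r /\
    forall a b : nat, phi [:: a; b] = r (a.+1%:R / b.+1%:R).

(** Rationals are named by fractions (p - n)/(d + 1), not necessarily reduced. *)
Definition rat_at (phi : name) (q : seq nat) : rat :=
  ((phi (0%N :: q))%:R - (phi (1%N :: q))%:R) / (phi (2%N :: q)).+1%:R.

Definition scalar_at (R : realType) (k : scalar_kind) (phi : name) (q : seq nat) :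
    scalars R k :=
  rat_scalar k (rat_at (subname phi 0) q) (rat_at (subname phi 1) q).

Arguments scalar_at {R} k.

(** In the next three definitions the branch [subname phi 0] describes the
    approximating sequence and [subname phi 1] its rate of convergence. *)

Definition names_real (K : numFieldType) (x : K) (phi : name) : Prop :=
  let u : nat -> K^o := fun n => ratr (rat_at (subname phi 0) [:: n]) in
  (u @ \oo --> (x : K^o)) /\ names_rate u (subname phi 1).

Definition names_scalar (R : realType) (k : scalar_kind) (x : scalars R k)
    (phi : name) : Prop :=
  let u : nat -> (scalars R k)^o := fun n => scalar_at k (subname phi 0) [:: n] in
  (u @ \oo --> (x : (scalars R k)^o)) /\ names_rate u (subname phi 1).

(** The [n]-th approximation is the combination of the first [phi [:: 2; n]] terms
    of [e]. *)
Definition names_vector (R : realType) (k : scalar_kind)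
    (H : normedModType (scalars R k)) (e : nat -> H) (x : H) (phi : name) : Prop :=
  let u : nat -> H := fun n =>
    \sum_(i < phi [:: 2%N; n])
      (scalar_at k (subname phi 0) [:: n; nat_of_ord i] : scalars R k) *: e i in
  (u @ \oo --> x) /\ names_rate u (subname phi 1).

Definition names_operator (R : realType) (k : scalar_kind)
    (H : normedModType (scalars R k)) (e : nat -> H) (T : H -> H) (phi : name) :
    Prop :=
  forall i : nat, names_vector e (T (e i)) (subname phi i).

(** * Separable Hilbert spaces with a computable basis *)

(** The inner product is linear in its first argument. *)
Definition induces_norm (R : realType) (k : scalar_kind)
    (H : normedModType (scalars R k)) (ip : {dot H for @conj_scalar R k}) : Prop :=
  forall x : H, `|x| ^+ 2 = ip x x.

(** A basis is a linearly independent family with dense span, not necessarily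
    orthonormal. The basis of a finite-dimensional space is padded with zeros to
    an infinite sequence. *)
Definition is_basis (K : numFieldType) (H : normedModType K) (e : nat -> H) : Prop :=
  [/\ forall i j : nat, (i <= j)%N -> e i = 0 -> e j = 0,
      forall (n : nat) (c : nat -> K), (forall i, (i < n)%N -> e i != 0) ->
        \sum_(i < n) c i *: e i = 0 -> forall i, (i < n)%N -> c i = 0
    & dense [set x : H | exists (n : nat) (c : nat -> K),
                           x = \sum_(i < n) c i *: e i]].

Definition computable_inner_product (R : realType) (k : scalar_kind)
    (H : normedModType (scalars R k)) (e : nat -> H)
    (ip : {dot H for @conj_scalar R k}) : Prop :=
  exists P : program, forall (x y : H) (phix phiy : name),
    names_vector e x phix -> names_vector e y phiy ->
    computes_some P [:: phix; phiy] (names_scalar (ip x y)).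

Definition computable_norm (R : realType) (k : scalar_kind)
    (H : normedModType (scalars R k)) (e : nat -> H) : Prop :=
  exists P : program, forall (x : H) (phix : name),
    names_vector e x phix ->
    computes_some P [:: phix] (names_real `|x|).

(** * Ergodic averages *)

Definition nonexpansive (K : numFieldType) (H : normedModType K) (T : H -> H) : Prop :=
  forall f : H, `|T f| <= `|f|.

Definition ergodic_average (K : numFieldType) (H : normedModType K)
    (T : H -> H) (f : H) (n : nat) : H :=
  n%:R^-1 *: \sum_(0 <= i < n) iter i T f.

(* Main.v *)
Require Import Defs.
From mathcomp Require Import all_boot all_order all_algebra.
From mathcomp Require Import complex.
From mathcomp Require Import all_classical all_reals all_analysis.
From mathcomp Require Import zify ring lra.
Import Order.TTheory GRing.Theory Num.Theory.
Import numFieldNormedType.Exports.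
Set Implicit Arguments.
Unset Strict Implicit.
Unset Printing Implicit Defensive.
Local Open Scope classical_set_scope.
Local Open Scope ring_scope.

(** Call [h - T h] the coboundary of [h], and let the coset of [f] consist of
    the vectors [f - (h - T h)]. It contains every average [A_n f] with [n > 0]
    and is stable under averaging and midpoints. Averaging a coboundary
    telescopes, so [g = f - (h - T h)] satisfies
    [|A_n f - A_n g| <= 2 |h| / n]: all members of the coset have the same
    limit [f*], and [|f*| <= |g|] because averaging does not increase norms.

    Now suppose that [|g|^2 <= |f*|^2 + d^2 / 4]. The midpoint of [g] and
    [A_n g] belongs to the coset, so its norm is at least [|f*|], and the
    parallelogram law gives [|A_n g - g| <= d] for every [n > 0]. Hence
    [|f* - g| <= d] ([limit_near]) and [|A_n f - g| <= d + 2 |h| / n]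
    ([average_stable]). A single [h] therefore provides both an approximation
    of the limit and a rate for the averages. The same argument, with vectors
    of nearly minimal norm in the coset, shows that the averages converge
    ([average_cvg]).

    The algorithm enumerates the finite rational combinations [h] of basis
    vectors and stops when the norm of [f - (h - T h)] is recognized as small
    enough; this is where [|f*|] is used. Such an [h] exists since these
    combinations are dense and the norms [|A_n f|] tend to [|f*|]
    ([computable_coset_search]). The operator is never iterated: [T h] is a
    combination of the given vectors [T e_j].

    That the search can be carried out by a program is shown without writing
    programs: [computable] is a predicate on functions of oracle data and
    finitely many natural numbers, closed under substitution, recursion and
    unbounded search, and [computable_vector] lifts it to vectors that can be
    approximated by rational combinations. The program for the norm is used by
    replacing its oracle with the code that produces the name of the vector in
    question ([computable_name_run]). *)

(** * Real parts of scalars and real-valued norms *)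

Section Scalars.
Variables (R : realType).

(** The norm takes its values in the scalar field, which may be only partially
    ordered; real parts move estimates to [R]. *)
Definition re k : scalars R k -> R :=
  match k return scalars R k -> R with
  | RealScalars => idfun
  | ComplexScalars => @complex.Re R
  end.

Lemma reD k (x y : scalars R k) : re (x + y) = re x + re y.
Proof. by case: k x y => //= -[a b] [c d]. Qed.

Lemma re0 k : re (0 : scalars R k) = 0.
Proof. by case: k. Qed.

Lemma reN k (x : scalars R k) : re (- x) = - re x.
Proof. by apply/eqP; rewrite -subr_eq0 opprK -reD addNr re0. Qed.

Lemma re_rat k q : re (ratr q : scalars R k) = ratr q.
Proof. by case: k => //=; rewrite -(fmorph_rat (real_complex R)). Qed.

Lemma re_realM k (x : scalars R k) : x \is Num.real ->
  forall y, re (x * y) = re x * re y.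
Proof.
case: k x => //= -[a b]; rewrite complex_real => /eqP -> [c d] /=.
by rewrite mul0r subr0.
Qed.

Lemma re_le k (x y : scalars R k) : x <= y -> re x <= re y.
Proof. by case: k x y => //= x y; rewrite lecE => /andP[]. Qed.

Lemma re_lt k (x y : scalars R k) : x < y -> re x < re y.
Proof. by case: k x y => //= x y; rewrite ltcE => /andP[]. Qed.

Lemma real_le k (x y : scalars R k) : x \is Num.real -> y \is Num.real ->
  (x <= y) = (re x <= re y).
Proof.
case: k x y => //= -[a b] [c d]; rewrite !complex_real lecE /= => /eqP -> /eqP ->.
by rewrite eqxx.
Qed.

Lemma real_lt k (x y : scalars R k) : x \is Num.real -> y \is Num.real ->
  (x < y) = (re x < re y).
Proof.
case: k x y => //= -[a b] [c d]; rewrite !complex_real ltcE /= => /eqP -> /eqP ->.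
by rewrite eqxx.
Qed.

Lemma re_normc (z : R[i]) :
  re (`|z : scalars R ComplexScalars|) = Num.sqrt (complex.Re z ^+ 2 + complex.Im z ^+ 2).
Proof. exact: (congr1 (@complex.Re R) (normc_def z)). Qed.

Lemma re_norm_real k (x : scalars R k) : x \is Num.real -> re `|x| = `|re x|.
Proof.
case: k x => // -[a b]; rewrite complex_real => /eqP ->.
by rewrite re_normc /= expr0n /= addr0 sqrtr_sqr.
Qed.

Lemma ratr_real k q : (ratr q : scalars R k) \is Num.real.
Proof. by rewrite realE !ler0q lerq0 -realE num_real. Qed.

Lemma rat_scalarD k (a b c d : rat) :
  rat_scalar k a b + rat_scalar k c d = rat_scalar k (a + c) (b + d) :> scalars R k.
Proof. by case: k => /=; rewrite !rmorphD. Qed.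

Lemma rat_scalarN k (a b : rat) :
  - rat_scalar k a b = rat_scalar k (- a) (- b) :> scalars R k.
Proof. by case: k => /=; rewrite !rmorphN. Qed.

Definition mul_re k (a b c d : rat) :=
  if k is ComplexScalars then a * c - b * d else a * c.

(** Over the reals the second component is ignored, so the complex formula for it
    serves both fields. *)
Lemma rat_scalarM k (a b c d : rat) :
  rat_scalar k a b * rat_scalar k c d =
    rat_scalar k (mul_re k a b c d) (a * d + b * c) :> scalars R k.
Proof. by case: k => /=; rewrite ?rmorphD ?rmorphN /= !rmorphM. Qed.

Lemma rat_scalar_nat k n : rat_scalar k n%:R 0 = n%:R :> scalars R k.
Proof.
case: k => /=; rewrite ?ratr_nat // raddf0.
by rewrite complexr0 rmorph_nat.
Qed.

Lemma norm_rat_scalar k (a b : rat) :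
  re `|rat_scalar k a b : scalars R k| <= ratr (`|a| + `|b|).
Proof.
rewrite rmorphD /= !ratr_norm; case: k; first by rewrite /= lerDl.
rewrite re_normc /=.
rewrite -(ler_pXn2r (_ : (0 < 2)%N)) ?nnegrE ?sqrtr_ge0 ?addr_ge0 //.
rewrite sqr_sqrtr ?addr_ge0 ?sqr_ge0 //.
rewrite -[ratr a ^+ 2]real_normK ?num_real // -[ratr b ^+ 2]real_normK ?num_real //.
have := mulr_ge0 (normr_ge0 (ratr a : R)) (normr_ge0 (ratr b : R)).
nra.
Qed.

Lemma rat_scalar_dense k (c : scalars R k) (eps : R) : 0 < eps ->
  exists a b : rat, re `|c - rat_scalar k a b| < eps.
Proof.
move=> eps0.
have dens (x : R) : exists q : rat, `|x - ratr q| < eps / 2.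
  have [|q] := @rat_in_itvoo R (x - eps / 2) (x + eps / 2); first by lra.
  by rewrite in_itv /= => /andP[? ?]; exists q; rewrite ltr_norml; lra.
case: k c => [x|[x y]].
  by have [q xq] := dens x; exists q, 0 => /=; lra.
have [a xa] := dens x; have [b yb] := dens y; exists a, b.
rewrite re_normc /=.
apply: (@le_lt_trans _ _ (`|x - ratr a| + `|y - ratr b|)); last by lra.
rewrite -(ler_pXn2r (_ : (0 < 2)%N)) ?nnegrE ?sqrtr_ge0 ?addr_ge0 //.
rewrite sqr_sqrtr ?addr_ge0 ?sqr_ge0 //.
rewrite -[(x - _) ^+ 2]real_normK ?num_real // -[(y - _) ^+ 2]real_normK ?num_real //.
have := mulr_ge0 (normr_ge0 (x - ratr a)) (normr_ge0 (y - ratr b)).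
nra.
Qed.

Definition rnorm k (H : normedModType (scalars R k)) (x : H) : R := re `|x|.

Section NormR.
Variables (k : scalar_kind) (H : normedModType (scalars R k)).
Implicit Types x y z : H.

Lemma rnorm_ge0 x : 0 <= rnorm x.
Proof. by rewrite -(re0 k); apply: re_le. Qed.

Lemma rnorm0 : rnorm (0 : H) = 0.
Proof. by rewrite /rnorm normr0 re0. Qed.

Lemma rnormD x y : rnorm (x + y) <= rnorm x + rnorm y.
Proof. by rewrite -reD; apply: re_le; exact: ler_normD. Qed.

Lemma rnormN x : rnorm (- x) = rnorm x.
Proof. by rewrite /rnorm normrN. Qed.

Lemma rnorm_distC x y : rnorm (x - y) = rnorm (y - x).
Proof. by rewrite -rnormN opprB. Qed.

Lemma rnormB x y : rnorm (x - y) <= rnorm x + rnorm y.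
Proof. by rewrite -(rnormN y); exact: rnormD. Qed.

Lemma rnorm_tri z x y : rnorm (x - y) <= rnorm (x - z) + rnorm (z - y).
Proof. by rewrite -(addrNK z x) -(addrA (x - z)) (le_trans (rnormD _ _)) // addrNK. Qed.

Lemma rnormZ c x : rnorm (c *: x) = re `|c| * rnorm x.
Proof. by rewrite /rnorm normrZ re_realM // normr_real. Qed.

Lemma rnorm_sum n (u : nat -> H) : rnorm (\sum_(i < n) u i) <= \sum_(i < n) rnorm (u i).
Proof.
elim: n => [|n IH]; first by rewrite !big_ord0 rnorm0.
by rewrite !big_ord_recr /= (le_trans (rnormD _ _)) // lerD2r.
Qed.

Lemma norm_lt_rat x q : (`|x| < ratr q) = (rnorm x < ratr q).
Proof. by rewrite real_lt ?normr_real ?ratr_real // re_rat. Qed.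

Lemma inv_nat_lt (eps : R) : 0 < eps -> exists m : nat, m.+1%:R^-1 < eps.
Proof.
move=> eps0; exists (Num.truncn eps^-1).
rewrite invf_plt ?posrE //; exact: truncnS_gt.
Qed.

Lemma cvg_rnorm (u : nat -> H) x :
  u @ \oo --> x <->
  forall m, exists N, forall n, (N <= n)%N -> rnorm (x - u n) <= m.+1%:R^-1.
Proof.
rewrite cvgrPdist_le; split=> [ux m|ux eps eps0].
  have /ux [N _ NP] : (0 : scalars R k) < ratr m.+1%:R^-1 by rewrite ltr0q invr_gt0 ltr0n.
  exists N => n /NP /= /re_le.
  by rewrite re_rat fmorphV /= ratr_nat.
have eps0' : 0 < re eps by have := re_lt eps0; rewrite re0.
have [m mP] := inv_nat_lt eps0'; have [N NP] := ux m.
exists N => // n /= /NP ?; rewrite real_le ?normr_real ?ger0_real ?(ltW eps0) //.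
apply: le_trans (ltW mP); assumption.
Qed.

End NormR.

End Scalars.

(** * The mean ergodic theorem *)

Section MeanErgodic.
Variables (R : realType) (k : scalar_kind).
Variables (H : completeNormedModType (scalars R k)).
Variable (ip : {dot H for @conj_scalar R k}).
Hypothesis ip_norm : induces_norm ip.
Variable (T : {linear H -> H}).
Hypothesis T_nonexp : nonexpansive T.
Implicit Types f g h x y : H.

Lemma parallelogram x y :
  rnorm (x - y) ^+ 2 + rnorm (x + y) ^+ 2 = 2 * rnorm x ^+ 2 + 2 * rnorm y ^+ 2.
Proof.
have sq z : rnorm z ^+ 2 = re (ip z z).
  by rewrite -ip_norm !expr2 /rnorm re_realM // normr_real.
rewrite !sq !linearBl !linearDl !linearBr !linearDr /= !(reD, reN); ring.
Qed.

Lemma rnormZV n x : rnorm (n%:R^-1 *: x) = n%:R^-1 * rnorm x.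
Proof.
rewrite rnormZ ger0_norm ?invr_ge0 ?ler0n //; congr (_ * _).
by rewrite -(ratr_nat (scalars R k)) -fmorphV re_rat fmorphV /= ratr_nat.
Qed.

Lemma rnorm_nonexp x : rnorm (T x) <= rnorm x.
Proof. exact/re_le/T_nonexp. Qed.

Lemma rnorm_iter n x : rnorm (iter n T x) <= rnorm x.
Proof. by elim: n => //= n IH; exact: le_trans (rnorm_nonexp _) IH. Qed.

Notation A := (ergodic_average T).

Lemma iterB n x y : iter n T (x - y) = iter n T x - iter n T y.
Proof. by elim: n => //= n ->; rewrite raddfB. Qed.

Lemma averageB x y n : A (x - y) n = A x n - A y n.
Proof.
rewrite /ergodic_average -scalerBr -sumrB; congr (_ *: _).
by apply: eq_bigr => i _; rewrite iterB.
Qed.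

Lemma rnorm_average x n : rnorm (A x n) <= rnorm x.
Proof.
rewrite rnormZV; case: n => [|n]; first by rewrite invr0 mul0r rnorm_ge0.
rewrite mulrC ler_pdivrMr ?ltr0n // big_mkord (le_trans (rnorm_sum _ _)) //.
apply: (@le_trans _ _ (\sum_(i < n.+1) rnorm x)); first by apply: ler_sum => i _; exact: rnorm_iter.
by rewrite sumr_const card_ord mulr_natr.
Qed.

Definition coboundary h := h - T h.

Lemma coboundaryD x y : coboundary (x + y) = coboundary x + coboundary y.
Proof. by rewrite /coboundary raddfD /= opprD addrACA. Qed.

Lemma coboundaryZ c x : coboundary (c *: x) = c *: coboundary x.
Proof. by rewrite /coboundary linearZ /= scalerBr. Qed.

Lemma rnorm_coboundary h : rnorm (coboundary h) <= 2 * rnorm h.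
Proof. by have := rnormB h (T h); have := rnorm_nonexp h; rewrite /coboundary; lra. Qed.

Lemma sum_coboundary h n : \sum_(0 <= i < n) iter i T (coboundary h) = h - iter n T h.
Proof.
elim: n => [|n IH]; first by rewrite big_geq // subrr.
by rewrite big_nat_recr //= IH iterB -iterSr /= addrA subrK.
Qed.

(** The sum of the iterates telescopes to [h - T^n h]. *)
Lemma rnorm_average_coboundary h n : rnorm (A (coboundary h) n) <= 2 * rnorm h / n%:R.
Proof.
rewrite /ergodic_average rnormZV sum_coboundary mulrC ler_wpM2r ?invr_ge0 ?ler0n //.
by have := rnormB h (iter n T h); have := rnorm_iter n h; lra.
Qed.

(** [f - T^i f] is the coboundary of the sum of the [T^j f] with [j < i]; average
    this over [i]. *)
Lemma average_in_coset f n : (0 < n)%N -> exists h, A f n = f - coboundary h.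
Proof.
move=> n0; exists (n%:R^-1 *: \sum_(0 <= i < n) \sum_(0 <= j < i) iter j T f).
have cob i : coboundary (\sum_(0 <= j < i) iter j T f) = f - iter i T f.
  rewrite -sum_coboundary /coboundary raddf_sum -sumrB; apply: eq_bigr => j _.
  by rewrite iterB -iterSr.
have cobs : coboundary (\sum_(0 <= i < n) \sum_(0 <= j < i) iter j T f) =
    \sum_(0 <= i < n) (f - iter i T f).
  by rewrite -(eq_bigr _ (fun i _ => cob i)) /coboundary raddf_sum -sumrB.
rewrite coboundaryZ cobs sumrB scalerBr sumr_const_nat subn0 -scalerMnr scalerMnl.
rewrite -mulr_natr mulVf ?pnatr_eq0 ?lt0n_neq0 // scale1r opprB addrC.
by rewrite subrK.
Qed.

Definition near_minimal f (d : R) g :=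
  forall h, rnorm g ^+ 2 <= rnorm (f - coboundary h) ^+ 2 + d.

(** Otherwise the squared norm could be lowered by [d] again and again until it
    became negative. *)
Lemma near_minimal_exists f d : 0 < d ->
  exists h, near_minimal f d (f - coboundary h).
Proof.
move=> d0; apply: contrapT => /forallNP no.
(* [n] improvements in a row. *)
have step n : exists h, rnorm (f - coboundary h) ^+ 2 <= rnorm f ^+ 2 - n%:R * d.
  elim: n => [|n [h hP]].
    by exists 0; rewrite /coboundary raddf0 !subr0 mul0r subr0.
  have /existsNP[h' /negP] := no h; rewrite -ltNge => h'P.
  by exists h'; rewrite -natr1; lra.
have [h] := step (Num.truncn (rnorm f ^+ 2 / d)).+1.
have : rnorm f ^+ 2 / d < (Num.truncn (rnorm f ^+ 2 / d)).+1%:R by exact: truncnS_gt.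
rewrite ltr_pdivrMr // => lt le.
by have := sqr_ge0 (rnorm (f - coboundary h)); lra.
Qed.

(** The midpoint of [g] and [A g n] lies in the coset, hence is hardly shorter than
    [g], while [A g n] is no longer than [g]. By the parallelogram law they are
    close. *)
Lemma near_minimal_average f d g h n : g = f - coboundary h ->
  near_minimal f d g -> (0 < n)%N -> rnorm (A g n - g) ^+ 2 <= 4 * d.
Proof.
move=> gh gmin n0.
have [h' h'P] := average_in_coset g n0.
have := gmin (2%:R^-1 *: h' + h).
have -> : f - coboundary (2%:R^-1 *: h' + h) = 2%:R^-1 *: (A g n + g).
  rewrite h'P coboundaryD coboundaryZ opprD addrA addrAC -gh.
  rewrite [in RHS]addrAC [RHS]scalerBr [in RHS]scalerDr -[in RHS]scalerDl.
  by rewrite -[2%:R^-1 + _](_ : 1 = _) ?scale1r // [LHS]splitr !mul1r.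
rewrite rnormZV; have := parallelogram (A g n) g; have := rnorm_average g n.
move: (rnorm_ge0 (A g n)); nra.
Qed.

Lemma average_near f h n :
  rnorm (A f n - A (f - coboundary h) n) <= 2 * rnorm h / n%:R.
Proof. by rewrite averageB opprB addrC subrK; exact: rnorm_average_coboundary. Qed.

Lemma nat_div_small (c eps : R) : 0 < eps ->
  exists N, forall n, (N <= n)%N -> c / n%:R < eps.
Proof.
move=> eps0; exists (Num.truncn (c / eps)).+1 => n Nn.
have n0 : (0 : R) < n%:R by rewrite ltr0n; apply: leq_trans Nn.
rewrite ltr_pdivrMr // mulrC -ltr_pdivrMr //.
by apply: lt_le_trans (truncnS_gt _) _; rewrite ler_nat.
Qed.

(** Mean ergodic theorem: a nearly minimal [g] in the coset is almost fixed by
    averaging, and the averages of [f] and of [g] are asymptotic, so the averages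
    of [f] eventually stay near [g]. *)
Lemma average_cvg f : A f @ \oo --> limn (A f).
Proof.
have : cvgn (A f); last by [].
apply/cauchy_cvgP/cauchy_exP => eps eps0.
have e0 : 0 < re eps by have := re_lt eps0; rewrite re0.
set e := re eps in e0.
have d0 : 0 < e ^+ 2 / 16 by rewrite divr_gt0 ?exprn_gt0.
have [h hmin] := near_minimal_exists f d0.
exists (f - coboundary h).
have e2 : 0 < e / 2 by lra.
have [N NP] := nat_div_small (2 * rnorm h) e2.
exists N.+1 => // n /= Nn; rewrite -ball_normE /= real_lt ?normr_real ?gtr0_real //.
have n0 : (0 < n)%N by exact: leq_trans Nn.
have := near_minimal_average erefl hmin n0; set g := f - _ => gn.
have {}gn : rnorm (A g n - g) <= e / 2.
  by rewrite -(ler_pXn2r (_ : (0 < 2)%N)) ?nnegrE ?rnorm_ge0 ?divr_ge0 ?(ltW e0) //; lra.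
have := average_near f h n; have := NP n (ltnW Nn) => fn1 fn2.
change (rnorm (g - A f n) < e).
have := rnorm_tri (A g n) g (A f n); rewrite (rnorm_distC g (A g n)) (rnorm_distC (A g n) (A f n)).
rewrite -/g in fn2; lra.
Qed.

Notation fstar f := (limn (A f)).

Lemma average_eventually f (eps : R) : 0 < eps ->
  exists N, forall n, (N <= n)%N -> rnorm (fstar f - A f n) < eps.
Proof.
move=> eps0; have [m mP] := inv_nat_lt eps0.
have [N NP] := (cvg_rnorm _ _).1 (@average_cvg f) m.
by exists N => n /NP /le_lt_trans; apply.
Qed.

(** The averages of all members of the coset have the limit of [f], and averaging
    does not increase norms. *)
Lemma le_rnorm_coset f h : rnorm (fstar f) <= rnorm (f - coboundary h).
Proof.
apply/ler_addgt0Pr => eps eps0.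
have e2 : 0 < eps / 2 by lra.
have [N NP] := average_eventually f e2.
have [M MP] := nat_div_small (2 * rnorm h) e2.
have := NP (maxn N M) (leq_maxl _ _); have := MP (maxn N M) (leq_maxr _ _).
set n := maxn N M => H1 H2.
have := average_near f h n; have := rnorm_average (f - coboundary h) n.
have := rnormD (fstar f - A f n) (A f n - A (f - coboundary h) n).
have := rnormD ((fstar f - A f n) + (A f n - A (f - coboundary h) n)) (A (f - coboundary h) n).
rewrite addrA subrK subrK; lra.
Qed.

Lemma coset_approaches f (eps : R) : 0 < eps ->
  exists h, rnorm (f - coboundary h) < rnorm (fstar f) + eps.
Proof.
move=> eps0; have [N NP] := average_eventually f eps0.
have [h hP] := average_in_coset f (ltn0Sn N); exists h; rewrite -hP.
have := NP N.+1 (leqnSn N); have := rnormD (fstar f) (A f N.+1 - fstar f).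
rewrite addrC subrK rnorm_distC; lra.
Qed.

(** The two error terms behave differently: [d] measures how far [f - coboundary h]
    is from minimal, and the other one, which depends on [h], vanishes for large
    [n]. *)
Lemma average_stable f h d n :
  rnorm (f - coboundary h) ^+ 2 <= rnorm (fstar f) ^+ 2 + d ^+ 2 / 4 -> 0 <= d -> (0 < n)%N ->
  rnorm (A f n - (f - coboundary h)) <= d + 2 * rnorm h / n%:R.
Proof.
set g := f - _ => gd d0 n0.
have gmin : near_minimal f (d ^+ 2 / 4) g.
  move=> h'; apply: le_trans gd _; rewrite lerD2r.
  by rewrite ler_pXn2r ?nnegrE ?rnorm_ge0 // le_rnorm_coset.
have gn : rnorm (A g n - g) <= d.
  rewrite -(ler_pXn2r (_ : (0 < 2)%N)) ?nnegrE ?rnorm_ge0 //.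
  by have := near_minimal_average erefl gmin n0; lra.
have := average_near f h n; rewrite -/g.
have := rnorm_tri (A g n) (A f n) g; lra.
Qed.

Lemma limit_near f h d :
  rnorm (f - coboundary h) ^+ 2 <= rnorm (fstar f) ^+ 2 + d ^+ 2 / 4 -> 0 <= d ->
  rnorm (fstar f - (f - coboundary h)) <= d.
Proof.
move=> gd d0; apply/ler_addgt0Pr => eps eps0.
have e2 : 0 < eps / 2 by lra.
have [N NP] := average_eventually f e2.
have [M MP] := nat_div_small (2 * rnorm h) e2.
have := NP (maxn N M).+1 (leqW (leq_maxl _ _)).
have := MP (maxn N M).+1 (leqW (leq_maxr _ _)).
set n := (maxn N M).+1 => H1 H2.
have := average_stable gd d0 (ltn0Sn _ : (0 < n)%N).
have := rnorm_tri (A f n) (fstar f) (f - coboundary h); lra.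
Qed.

End MeanErgodic.

(** * Evaluation and linking of programs *)

Definition eval_to P O env t v := exists fuel, run P O fuel env t = Some v.

Fixpoint eval_all P O env ts vs : Prop :=
  match ts, vs with
  | [::], [::] => True
  | t :: ts', v :: vs' => eval_to P O env t v /\ eval_all P O env ts' vs'
  | _, _ => False
  end.

Definition subprogram (P Q : program) :=
  forall i b, onth P i = Some b -> onth Q i = Some b.

Lemma all_some_map_mono (T : Type) (f g : T -> option nat) ts vs :
  (forall t v, f t = Some v -> g t = Some v) ->
  all_some (map f ts) = Some vs -> all_some (map g ts) = Some vs.
Proof.
move=> fg; elim: ts vs => [|t ts IH] vs //=.
case ft: (f t) => [v|//]; rewrite (fg _ _ ft).
case fts: (all_some (map f ts)) => [ws|//] /= [<-].
by rewrite (IH _ fts).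
Qed.

Lemma run_mono P Q O fuel fuel' env t v :
  subprogram P Q -> (fuel <= fuel')%N ->
  run P O fuel env t = Some v -> run Q O fuel' env t = Some v.
Proof.
move=> PQ; elim: fuel fuel' env t v => [//|n IH] [//|n'] env t v; rewrite ltnS => nn'.
have IH' env' t' v' := IH _ env' t' v' nn'.
case: t => [i||t|t|t1 t2 t3|g ts|o ts] //=.
- by case e: run => [w|//]; rewrite (IH' _ _ _ e).
- by case e: run => [w|//]; rewrite (IH' _ _ _ e).
- case e: run => [w|//]; rewrite (IH' _ _ _ e) /=; exact: IH'.
- case e: all_some => [vs|//].
  rewrite (all_some_map_mono (IH' env) e) /=.
  by case eg: onth => [b|//]; rewrite (PQ _ _ eg) /=; exact: IH'.
- case e: all_some => [vs|//].
  by rewrite (all_some_map_mono (IH' env) e).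
Qed.

Lemma subprogram_refl P : subprogram P P. Proof. by []. Qed.

Lemma subprogram_cat P Q : subprogram P (P ++ Q).
Proof.
by elim: P => [|c P IH] [|i] b //=; exact: IH.
Qed.

Lemma eval_sub P Q O env t v : subprogram P Q -> eval_to P O env t v -> eval_to Q O env t v.
Proof. by move=> PQ [n r]; exists n; apply: (run_mono PQ) r. Qed.

Lemma eval_all_sub P Q O env ts vs :
  subprogram P Q -> eval_all P O env ts vs -> eval_all Q O env ts vs.
Proof.
move=> PQ; elim: ts vs => [|t ts IH] [|v vs] //= [/(eval_sub PQ) ? /IH].
by split.
Qed.

Lemma eval_all_run P O env ts vs :
  eval_all P O env ts vs ->
  exists fuel, all_some (map (run P O fuel env) ts) = Some vs.
Proof.
elim: ts vs => [|t ts IH] [|v vs] //= => [_|[[n rt] /IH[m rts]]].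
  by exists 0%N.
exists (maxn n m).
rewrite (run_mono (@subprogram_refl P) (leq_maxl n m) rt).
suff -> : all_some (map (run P O (maxn n m) env) ts) = Some vs by [].
apply: all_some_map_mono rts => t' v'; apply: run_mono => //.
exact: leq_maxr.
Qed.

Lemma eval_all_cat P O env ts vs ts' vs' :
  eval_all P O env ts vs -> eval_all P O env ts' vs' -> eval_all P O env (ts ++ ts') (vs ++ vs').
Proof. by elim: ts vs => [|t ts IH] [|v vs] //= [? /IH E] /E. Qed.

Lemma eval_var P O env i : eval_to P O env (Var i) (nth 0%N env i).
Proof. by exists 1%N. Qed.

Lemma eval_zero P O env : eval_to P O env Zero 0.
Proof. by exists 1%N. Qed.

Lemma eval_succ P O env t v : eval_to P O env t v -> eval_to P O env (Succ t) v.+1.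
Proof. by move=> [n r]; exists n.+1; rewrite /= r. Qed.

Lemma eval_pred P O env t v : eval_to P O env t v -> eval_to P O env (Pred t) v.-1.
Proof. by move=> [n r]; exists n.+1; rewrite /= r. Qed.

Lemma eval_ifz P O env t1 t2 t3 v w :
  eval_to P O env t1 v -> eval_to P O env (if v == 0 then t2 else t3)%N w ->
  eval_to P O env (Ifz t1 t2 t3) w.
Proof.
move=> [n r1] [m r2]; exists (maxn n m).+1 => /=.
rewrite (run_mono (@subprogram_refl P) (leq_maxl n m) r1) /=.
exact: (run_mono (@subprogram_refl P) (leq_maxr n m) r2).
Qed.

Lemma eval_call P O env g b ts vs v :
  onth P g = Some b -> eval_all P O env ts vs -> eval_to P O vs b v ->
  eval_to P O env (Call g ts) v.
Proof.
move=> Pg /eval_all_run[n rs] [m r]; exists (maxn n m).+1 => /=.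
rewrite (@all_some_map_mono _ _ (run P O (maxn n m) env) _ _ _ rs) /=; last first.
  move=> t' v'; apply: run_mono => //; exact: leq_maxl.
by rewrite Pg /=; apply: run_mono r => //; exact: leq_maxr.
Qed.

Lemma eval_ask P O env o ts vs :
  eval_all P O env ts vs -> eval_to P O env (Ask o ts) (nth (fun=> 0%N) O o vs).
Proof. by move=> /eval_all_run[n rs]; exists n.+1; rewrite /= rs. Qed.

Lemma eval_all_vars P O pre env post :
  eval_all P O (pre ++ env ++ post) (map Var (iota (size pre) (size env))) env.
Proof.
elim: env pre => [|v env IH] pre //=; split.
  have := eval_var P O (pre ++ v :: env ++ post) (size pre).
  by rewrite nth_cat ltnn subnn.
by have := IH (rcons pre v); rewrite size_rcons cat_rcons.
Qed.

(** A missing argument reads as 0, and [Zero] is the default expression. *)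
Lemma eval_all_take P O env ts vs n :
  eval_all P O env ts vs ->
  eval_all P O env (mkseq (nth Zero ts) n) (mkseq (nth 0%N vs) n).
Proof.
move=> E; have En i : eval_to P O env (nth Zero ts i) (nth 0%N vs i).
  elim: ts vs i E => [|t ts IH] [|v vs] // i; first by rewrite !nth_nil => _; exact: eval_zero.
  by move=> [E Es]; case: i => [|i] //=; exact: IH.
rewrite /mkseq; elim: (iota 0 n) => //= i s IHs; by split.
Qed.

Section Translation.
Variables (offset captured : nat) (ask : nat -> seq expr -> expr).

(** Function [g] becomes function [offset + g], every function takes [captured]
    additional arguments in front, and oracle calls become what [ask] makes of
    them. With [captured = 0] and [ask = Ask] this relocates a program inside a
    larger one; if [ask] calls a subroutine, it replaces the oracle by a name
    computed from the captured values. *)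
Fixpoint translate (t : expr) : expr :=
  match t with
  | Var i => Var (captured + i)
  | Zero => Zero
  | Succ t1 => Succ (translate t1)
  | Pred t1 => Pred (translate t1)
  | Ifz t1 t2 t3 => Ifz (translate t1) (translate t2) (translate t3)
  | Call g ts => Call (offset + g) (map Var (iota 0 captured) ++ map translate ts)
  | Ask o ts => ask o (map translate ts)
  end.

Lemma translateP P Q O O' cap :
  size cap = captured ->
  (forall i b, onth P i = Some b -> onth Q (offset + i) = Some (translate b)) ->
  (forall o env ts vs, eval_all Q O' (cap ++ env) ts vs ->
     eval_to Q O' (cap ++ env) (ask o ts) (nth (fun=> 0%N) O o vs)) ->
  forall env t v, eval_to P O env t v -> eval_to Q O' (cap ++ env) (translate t) v.
Proof.
move=> scap PQ askP env t v [n]; elim: n env t v => [//|n IH] env t v.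
have IHs ts vs : all_some (map (run P O n env) ts) = Some vs ->
    eval_all Q O' (cap ++ env) (map translate ts) vs.
  elim: ts vs => [|t' ts IHts] vs /=; first by move=> [<-].
  case e: run => [w|//]; case es: all_some => [ws|//] [<-] /=.
  by split; [exact: IH e | exact: IHts].
case: t => [i||t|t|t1 t2 t3|g ts|o ts] /=.
- move=> [<-]; have := eval_var Q O' (cap ++ env) (captured + i).
  by rewrite nth_cat -scap ltnNge leq_addr /= addKn.
- by move=> [<-]; exact: eval_zero.
- by case e: run => [w|//] [<-]; apply: eval_succ; exact: IH e.
- by case e: run => [w|//] [<-]; apply: eval_pred; exact: IH e.
- case e: run => [w|//] /= r; apply: eval_ifz (IH _ _ _ e) _.
  by case: (w == 0)%N r => r; exact: IH r.
- case e: all_some => [vs|//]; case eg: onth => [b|//] /= r.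
  apply: eval_call (PQ _ _ eg) _ (IH _ _ _ r).
  apply: eval_all_cat (IHs _ _ e).
  by have := eval_all_vars Q O' [::] cap env; rewrite scap.
- by case e: all_some => [vs|//] [<-]; apply: askP; exact: IHs.
Qed.
End Translation.

Lemma onth_cat_map (f : expr -> expr) P Q i b :
  onth P i = Some b -> onth (Q ++ map f P) (size Q + i) = Some (f b).
Proof.
elim: Q => [|c Q IH] /=; last by move/IH.
by elim: P i => [|c P IH] [|i] //= => [[->]|/IH].
Qed.

Lemma link P1 P2 : exists (Q : program) (tr : expr -> expr),
  subprogram P1 Q /\
  forall O env t v, eval_to P2 O env t v -> eval_to Q O env (tr t) v.
Proof.
pose tr := translate (size P1) 0 Ask.
exists (P1 ++ map tr P2), tr; split; first exact: subprogram_cat.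
move=> O env t v; apply: (@translateP _ _ _ _ _ O O [::]) => //.
- by move=> i b; exact: onth_cat_map.
- by move=> o env' ts vs; exact: eval_ask.
Qed.

Lemma onth_rcons (P : program) b : onth (rcons P b) (size P) = Some b.
Proof. by elim: P. Qed.

Lemma subprogram_rcons (P : program) b : subprogram P (rcons P b).
Proof. by rewrite -cats1; exact: subprogram_cat. Qed.

(** * Computable functions of oracle data *)

Section Computability.
Variables (D : Type) (oracles : D -> seq name).
Local Open Scope nat_scope.

(** What a piece of code may refer to: a datum, whose names are the oracles, and
    the values of variables. Their number is fixed because a call has to list its
    arguments. *)
Record context := Context {
  carrier :> Type;
  datum : carrier -> D;
  vars : carrier -> seq nat;
  arity : nat;
  size_vars : forall x, size (vars x) = arity
}.

Definition base_context : context := @Context D id (fun=> [::]) 0 (fun=> erefl).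

(** The variable bound last comes first, as with de Bruijn indices. *)
Definition ext (G : context) : context :=
  @Context (G * nat)%type (fun p => datum p.1) (fun p => p.2 :: vars p.1)
    (arity G).+1 (fun p => congr1 succn (size_vars p.1)).

Definition evaluates P G t (f : carrier G -> nat) :=
  forall x : G, eval_to P (oracles (datum x)) (vars x) t (f x).

Definition computable G (f : carrier G -> nat) := exists P t, @evaluates P G t f.

Lemma eq_computable G (f g : carrier G -> nat) : f =1 g -> computable f -> computable g.
Proof. by move=> fg [P [t E]]; exists P, t => x; rewrite -fg. Qed.

Lemma computable_common G1 G2 (f1 : carrier G1 -> nat) (f2 : carrier G2 -> nat) :
  computable f1 -> computable f2 ->
  exists P t1 t2, evaluates P t1 f1 /\ evaluates P t2 f2.
Proof.
move=> [P1 [t1 E1]] [P2 [t2 E2]]; have [Q [tr [sub trP]]] := link P1 P2.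
by exists Q, t1, (tr t2); split=> x; [exact: eval_sub (E1 x) | exact: trP].
Qed.

Fixpoint computables G (fs : seq (carrier G -> nat)) : Prop :=
  if fs is f :: fs' then computable f /\ computables fs' else True.

Lemma computables_eval_all G (fs : seq (carrier G -> nat)) : computables fs ->
  exists P ts, forall x : G,
    eval_all P (oracles (datum x)) (vars x) ts [seq f x | f <- fs].
Proof.
elim: fs => [_|f fs IH] /=; first by exists [::], [::].
move=> [[P1 [t1 E1]] /IH[P2 [ts E2]]].
have [Q [tr [sub trP]]] := link P1 P2.
exists Q, (t1 :: map tr ts) => x; split; first exact: eval_sub (E1 x).
move: (map _ _) (E2 x) => /=; elim: ts {E2} => [|t ts IHts] [|v vs] //= [/trP ? /IHts].
by split.
Qed.

(** A simultaneous substitution of computable values for the variables of [G]. *)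
Definition morphism_of G' G (s : carrier G' -> carrier G) :=
  (forall y, datum (s y) = datum y) /\
  exists2 fs : seq (carrier G' -> nat), computables fs &
    forall y, vars (s y) = [seq f y | f <- fs].

(** The code of [f] becomes the body of a function, which is called with the values
    to be substituted. *)
Lemma computable_subst G' G (f : carrier G -> nat) (s : carrier G' -> carrier G) :
  morphism_of s -> computable f -> computable (fun y => f (s y)).
Proof.
move=> [sD [fs /computables_eval_all[P2 [ts E2]] sV]] [P1 [t E1]].
have [Q [tr [sub trP]]] := link P2 P1.
exists (rcons Q (tr t)), (Call (size Q) ts) => y.
apply: (eval_call (b := tr t) (vs := vars (s y))).
- exact: onth_rcons.
- apply: eval_all_sub (@subprogram_rcons Q _) _.
  by rewrite sV; apply: eval_all_sub sub _; exact: E2.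
- apply: eval_sub (@subprogram_rcons Q _) _.
  by rewrite -(sD y); apply: trP; exact: E1.
Qed.

Lemma computable_head G : computable (G := ext G) (fun p => p.2).
Proof. by exists [::], (Var 0) => x; exact: eval_var. Qed.

Lemma vars_nth G n (x : carrier G) : n = arity G ->
  vars x = [seq nth 0 (vars x) i | i <- iota 0 n].
Proof. by move=> ->; rewrite map_nth_iota0 ?size_vars // -(size_vars x) take_size. Qed.

Lemma morphism_fst G : morphism_of (G' := ext G) (G := G) (fun p => p.1).
Proof.
split=> //; exists [seq (fun p : ext G => nth 0 (vars p.1) i) | i <- iota 0 (arity G)].
  elim: (iota _ _) => //= i s ?; split=> //.
  by exists [::], (Var i.+1) => x; have := eval_var [::] (oracles (datum x)) (vars x) i.+1.
by move=> y; rewrite -map_comp; exact: vars_nth.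
Qed.

Lemma morphism_id G : morphism_of (G' := G) (G := G) id.
Proof.
split=> //; exists [seq (fun p : G => nth 0 (vars p) i) | i <- iota 0 (arity G)].
  elim: (iota _ _) => //= i s ?; split=> //.
  by exists [::], (Var i) => x; exact: eval_var.
by move=> y; rewrite -map_comp; exact: vars_nth.
Qed.

Lemma computables_subst G' G (fs : seq (carrier G -> nat)) (s : carrier G' -> carrier G) :
  morphism_of s -> computables fs -> computables [seq (fun y => f (s y)) | f <- fs].
Proof.
move=> sP; elim: fs => //= f fs IH [cf /IH]; split=> //; exact: computable_subst cf.
Qed.

Lemma morphism_comp G'' G' G (t : carrier G'' -> carrier G') (s : carrier G' -> carrier G) :
  morphism_of t -> morphism_of s -> morphism_of (fun y => s (t y)).
Proof.
move=> tP [sD [fs cfs sV]]; split; first by move=> y; rewrite sD; case: tP.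
exists [seq (fun y => f (t y)) | f <- fs]; first exact: computables_subst.
by move=> y; rewrite sV -map_comp.
Qed.

Lemma morphism_fst2 G : morphism_of (G' := ext (ext G)) (G := G) (fun p => p.1.1).
Proof. exact: morphism_comp (@morphism_fst (ext G)) (@morphism_fst G). Qed.

Lemma morphism_pair G' G (s : carrier G' -> carrier G) (g : carrier G' -> nat) :
  morphism_of s -> computable g -> morphism_of (G := ext G) (fun y => (s y, g y)).
Proof.
move=> [sD [fs cfs sV]] cg; split=> //.
by exists (g :: fs) => // y /=; rewrite sV.
Qed.

Lemma morphism_lift G' G (s : carrier G' -> carrier G) : morphism_of s ->
  morphism_of (G' := ext G') (G := ext G) (fun p => (s p.1, p.2)).
Proof.
move=> sP; apply: morphism_pair; last exact: computable_head.
exact: (morphism_comp (@morphism_fst G') sP).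
Qed.

Lemma computable_weak G (f : carrier G -> nat) :
  computable f -> computable (G := ext G) (fun p => f p.1).
Proof. exact/computable_subst/morphism_fst. Qed.

Lemma computable_let G (f : carrier (ext G) -> nat) (g : carrier G -> nat) :
  computable f -> computable g -> computable (fun x => f (x, g x)).
Proof.
move=> cf cg; apply: computable_subst cf; apply: morphism_pair cg.
exact: morphism_id.
Qed.

Lemma computable_succ G (f : carrier G -> nat) : computable f -> computable (fun x => (f x).+1).
Proof. by move=> [P [t E]]; exists P, (Succ t) => x; apply: eval_succ. Qed.

Lemma computable_pred G (f : carrier G -> nat) : computable f -> computable (fun x => (f x).-1).
Proof. by move=> [P [t E]]; exists P, (Pred t) => x; apply: eval_pred. Qed.

Lemma computable_const G n : computable (G := G) (fun=> n).
Proof.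
elim: n => [|n IH]; last exact: computable_succ IH.
by exists [::], Zero => x; exact: eval_zero.
Qed.

Lemma computable_ifz G (c f g : carrier G -> nat) : computable c -> computable f -> computable g ->
  computable (fun x => if c x == 0 then f x else g x).
Proof.
move=> cc cf cg; have : computables [:: c; f; g] by [].
move=> /computables_eval_all[P [ts E]].
exists P, (Ifz (nth Zero ts 0) (nth Zero ts 1) (nth Zero ts 2)) => x.
have [e1 [e2 [e3 _]]] := eval_all_take 3 (E x).
by apply: eval_ifz e1 _; rewrite /=; case: ifP.
Qed.

(** The quantification over substitutions allows arguments that contain variables
    bound after the name was introduced. *)
Definition computable_name G (phi : carrier G -> name) :=
  forall G' (s : carrier G' -> carrier G), morphism_of s ->
  forall fs : seq (carrier G' -> nat), computables fs ->
    computable (fun y => phi (s y) [seq f y | f <- fs]).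

Lemma computable_name_ask G o :
  computable_name (G := G) (fun x => nth (fun=> 0) (oracles (datum x)) o).
Proof.
move=> G' s [sD _] fs /computables_eval_all[P [ts E]]; exists P, (Ask o ts) => y.
by rewrite sD; exact: eval_ask.
Qed.

Lemma computable_name_subst G' G (phi : carrier G -> name) (s : carrier G' -> carrier G) :
  morphism_of s -> computable_name phi -> computable_name (fun y => phi (s y)).
Proof. move=> sP cphi G'' t tP fs; apply: (cphi _ _ (morphism_comp tP sP)). Qed.

Lemma computable_name_subname G (phi : carrier G -> name) (f : carrier G -> nat) :
  computable_name phi -> computable f -> computable_name (fun x => subname (phi x) (f x)).
Proof.
move=> cphi cf G' s sP fs cfs.
by apply: (cphi _ _ sP ((fun y => f (s y)) :: fs)); split=> //; exact: computable_subst cf.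
Qed.

Lemma computable_name_app G (phi : carrier G -> name) (fs : seq (carrier G -> nat)) :
  computable_name phi -> computables fs -> computable (fun x => phi x [seq f x | f <- fs]).
Proof. move=> cphi cfs; exact: (cphi _ _ (morphism_id G)). Qed.

(** Among the queries to a name, those for coefficients of a vector have the most
    arguments: the constant 0, a component, a part of the fraction, the index of
    the approximation and the index of the coefficient. *)
Definition five_args (q : seq nat) := mkseq (nth 0 q) 5.

Definition implemented G (phi : carrier G -> name) :=
  (forall x q, phi x q = phi x (five_args q)) /\
  computable (G := ext (ext (ext (ext (ext G))))) (fun p =>
    phi p.1.1.1.1.1 [:: p.1.1.1.1.2; p.1.1.1.2; p.1.1.2; p.1.2; p.2]).

Lemma implemented_subst G' G (phi : carrier G -> name) (s : carrier G' -> carrier G) :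
  morphism_of s -> implemented phi -> implemented (fun y => phi (s y)).
Proof.
move=> sP [phi5 cphi]; split; first by move=> x q; exact: phi5.
have sP5 := morphism_lift (morphism_lift (morphism_lift (morphism_lift (morphism_lift sP)))).
exact: (computable_subst sP5 cphi).
Qed.

Lemma implemented_program (phi : carrier base_context -> name) : implemented phi ->
  exists P, forall d : D, computes P (oracles d) (phi d).
Proof.
move=> [phi5 [P [t E]]].
(* A context lists its variables innermost first, hence in reverse order. *)
pose vs := [:: Var 4; Var 3; Var 2; Var 1; Var 0].
exists (Call 1 vs :: translate 2 0 Ask t :: map (translate 2 0 Ask) P) => d q.
suff [n r] : eval_to (Call 1 vs :: translate 2 0 Ask t :: map (translate 2 0 Ask) P)
    (oracles d) q (Call 1 vs) (phi d q).
  by exists n; rewrite /=; exact: r.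
apply: (eval_call (b := translate 2 0 Ask t)
  (vs := [:: nth 0 q 4; nth 0 q 3; nth 0 q 2; nth 0 q 1; nth 0 q 0])) => //.
  by do !split; exact: eval_var.
rewrite phi5.
have := E (d, nth 0 q 0, nth 0 q 1, nth 0 q 2, nth 0 q 3, nth 0 q 4).
apply: (@translateP _ _ _ P _ (oracles d) _ [::]) => //.
  by move=> i b /(@onth_cat_map (translate 2 0 Ask) _ [:: Call 1 vs; translate 2 0 Ask t]).
by move=> o env' ts vs'; exact: eval_ask.
Qed.

(** The calls of [P] to its oracle become calls to the code of [phi]. As [phi]
    depends on the context, the variables of the context are handed down through
    all calls. *)
Lemma computable_name_run P G (phi psi : carrier G -> name) :
  implemented phi -> (forall x, computes P [:: phi x] (psi x)) -> computable_name psi.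
Proof.
suff main : forall G (phi psi : carrier G -> name), implemented phi ->
    (forall x, computes P [:: phi x] (psi x)) ->
    forall fs : seq (carrier G -> nat), computables fs ->
      computable (fun y => psi y [seq f y | f <- fs]).
  move=> iphi Ppsi G' s sP fs cfs.
  apply: (main _ (fun y => phi (s y)) (fun y => psi (s y))) => //.
  exact: implemented_subst iphi.
move=> {G phi psi} G phi psi [phi5 [P1 [t1 E1]]] Ppsi fs /computables_eval_all[P2 [ts E2]].
case P0: (onth P 0) => [b|]; last first.
  exists [::], Zero => x; have [n] := Ppsi x [::]; by rewrite P0.
(* The final program consists of the code for the arguments and for [phi], the
   entry point [tr t1] of the latter, and the translation of [P]. *)
have [Q0 [tr [sub0 trP]]] := link P2 P1.
pose Q1 := rcons Q0 (tr t1).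
pose caps := map Var (iota 0 (arity G)).
pose ask o ts := if o == 0 then Call (size Q0)
  ([:: nth Zero ts 4; nth Zero ts 3; nth Zero ts 2; nth Zero ts 1; nth Zero ts 0] ++ caps)
  else Zero.
pose trans := translate (size Q1) (arity G) ask.
pose Q := Q1 ++ map trans P.
have sQ1 : subprogram Q1 Q by exact: subprogram_cat.
have sQ0 : subprogram Q0 Q1 by exact: subprogram_rcons.
exists Q, (Call (size Q1) (caps ++ ts)) => x.
have capsP env : eval_all Q (oracles (datum x)) (vars x ++ env) caps (vars x).
  by have := eval_all_vars Q (oracles (datum x)) [::] (vars x) env; rewrite size_vars.
apply: (eval_call (b := trans b) (vs := vars x ++ [seq f x | f <- fs])).
- by have := onth_cat_map trans Q1 P0; rewrite addn0.
- apply: eval_all_cat; first by have := capsP [::]; rewrite cats0.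
  by apply: eval_all_sub sQ1 _; apply: eval_all_sub sQ0 _; apply: eval_all_sub sub0 _; exact: E2.
have [n r] := Ppsi x [seq f x | f <- fs]; rewrite P0 /= in r.
apply: (@translateP _ _ _ P _ [:: phi x]); first exact: size_vars.
- by move=> i c; exact: onth_cat_map.
- move=> o env us vs Es; rewrite /ask; case: o => [|o] /=; last first.
    by rewrite nth_nil; exact: eval_zero.
  apply: (eval_call (b := tr t1)
    (vs := [:: nth 0 vs 4; nth 0 vs 3; nth 0 vs 2; nth 0 vs 1; nth 0 vs 0] ++ vars x)).
  + by apply: sQ1; exact: onth_rcons.
  + by have [e0 [e1 [e2 [e3 [e4 _]]]]] := eval_all_take 5 Es; do !split => //.
  apply: eval_sub sQ1 _; apply: eval_sub sQ0 _; apply: trP.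
  by rewrite phi5; have := E1 (x, nth 0 vs 0, nth 0 vs 1, nth 0 vs 2, nth 0 vs 3, nth 0 vs 4).
- by exists n.
Qed.

Lemma computable_rec G (n b : carrier G -> nat) (s : carrier (ext (ext G)) -> nat) :
  computable n -> computable b -> computable s ->
  computable (fun x => nat_rect (fun=> nat) (b x) (fun k acc => s (x, k, acc)) (n x)).
Proof.
move=> cn cb cs.
apply: (@computable_let _ (fun p =>
  nat_rect (fun=> nat) (b p.1) (fun k acc => s (p.1, k, acc)) p.2) n) => //.
have [P [tb [ts [Eb Es]]]] := computable_common (computable_weak cb) cs.
pose caps := map Var (iota 1 (arity G)).
(* Function [size P] is the step, and the next one recurses on variable 0. *)
pose self := Call (size P).+1 (Pred (Var 0) :: caps).
pose body := Ifz (Var 0) tb (Call (size P) (self :: Pred (Var 0) :: caps)).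
pose Q := rcons (rcons P ts) body.
have sP : subprogram P Q.
  by move=> i c ?; apply: subprogram_rcons; exact: subprogram_rcons.
have Qts : onth Q (size P) = Some ts by apply: subprogram_rcons; exact: onth_rcons.
have Qbody : onth Q (size P).+1 = Some body.
  by have := onth_rcons (rcons P ts) body; rewrite size_rcons.
have capsP O k (x : G) : eval_all Q O (k :: vars x) caps (vars x).
  by have := eval_all_vars Q O [:: k] (vars x) [::]; rewrite cats0 size_vars.
exists Q, (Call (size P).+1 (Var 0 :: caps)) => -[x k] /=.
set O := oracles (datum x).
pose rec k := nat_rect (fun=> nat) (b x) (fun k acc => s (x, k, acc)) k.
have main : forall k, eval_to Q O (k :: vars x) body (rec k).
  elim=> [|i IH]; (apply: eval_ifz; first exact: eval_var); rewrite /=.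
    by apply: eval_sub sP _; exact: (Eb (x, 0)).
  apply: (eval_call (vs := [:: rec i, i & vars x]) Qts); last first.
    by apply: eval_sub sP _; exact: (Es (x, i, rec i)).
  have ei : eval_to Q O (i.+1 :: vars x) (Pred (Var 0)) i.
    exact: (eval_pred (eval_var Q O (i.+1 :: vars x) 0)).
  do 2?split=> //.
  by apply: (eval_call (vs := i :: vars x) Qbody).
apply: (eval_call (vs := k :: vars x) Qbody) => //; split=> //.
exact: (eval_var Q O (k :: vars x) 0).
Qed.

Lemma computable_mu G (p : carrier (ext G) -> bool) (exp : forall x : G, exists n, p (x, n)) :
  computable (fun y => p y : nat) -> computable (fun x => ex_minn (exp x)).
Proof.
move=> [P [t E]].
pose caps := map Var (iota 1 (arity G)).
pose body := Ifz t (Call (size P) (Succ (Var 0) :: caps)) (Var 0).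
pose Q := rcons P body.
have sP : subprogram P Q by exact: subprogram_rcons.
have Qbody : onth Q (size P) = Some body by exact: onth_rcons.
have capsP O k (x : G) : eval_all Q O (k :: vars x) caps (vars x).
  by have := eval_all_vars Q O [:: k] (vars x) [::]; rewrite cats0 size_vars.
exists Q, (Call (size P) (Zero :: map Var (iota 0 (arity G)))) => x /=.
case: ex_minnP => m pm minm.
set O := oracles (datum x).
have main : forall d k, d + k = m -> eval_to Q O (k :: vars x) body m.
  elim=> [|d IH] k km; (apply: eval_ifz; first by apply: eval_sub sP _; exact: (E (x, k))).
    by rewrite (_ : k = m) ?pm; first exact: eval_var; rewrite -km.
  have -> : p (x, k) = false by apply/negP => /minm; lia.
  rewrite /=; apply: (eval_call (vs := k.+1 :: vars x) Qbody); last by apply: IH; lia.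
  split=> //; exact: (eval_succ (eval_var Q O (k :: vars x) 0)).
apply: (eval_call (vs := 0 :: vars x) Qbody); last by apply: (main m); lia.
split; first exact: eval_zero.
by have := eval_all_vars Q O [::] (vars x) [::]; rewrite cats0 size_vars.
Qed.

End Computability.

(** * Computable arithmetic *)

Section Arithmetic.
Variables (D : Type) (oracles : D -> seq name).
Notation context := (context D).
Notation computable := (computable oracles).
Notation morphism_of := (morphism_of oracles).
Implicit Type G : context.
Local Open Scope nat_scope.

Lemma computable_add G (f g : carrier G -> nat) :
  computable f -> computable g -> computable (fun x => f x + g x).
Proof.
move=> cf cg; apply: eq_computable (computable_rec cg cf (computable_succ (computable_head _ _))) => x /=.
by elim: (g x) => /= [|n ->]; rewrite ?addn0 ?addnS.
Qed.

Lemma computable_sub G (f g : carrier G -> nat) :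
  computable f -> computable g -> computable (fun x => f x - g x).
Proof.
move=> cf cg; apply: eq_computable (computable_rec cg cf (computable_pred (computable_head _ _))) => x /=.
by elim: (g x) => /= [|n ->]; rewrite ?subn0 ?subnS.
Qed.

Lemma computable_sum G (n : carrier G -> nat) (f : carrier G -> nat -> nat) :
  computable n -> computable (G := ext G) (fun p => f p.1 p.2) ->
  computable (fun x => \sum_(i < n x) f x i).
Proof.
move=> cn cf.
apply: eq_computable (computable_rec cn (computable_const oracles G 0)
  (computable_add (computable_head _ _) (computable_weak cf))) => x /=.
by elim: (n x) => /= [|m ->]; rewrite ?big_ord0 ?big_ord_recr.
Qed.

Lemma computable_mul G (f g : carrier G -> nat) :
  computable f -> computable g -> computable (fun x => f x * g x).
Proof.
move=> cf cg; apply: eq_computable (computable_sum (f := fun x _ => f x) cg (computable_weak cf)) => x /=.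
by rewrite big_const_ord iter_addn_0.
Qed.

Lemma computable_prod G (n : carrier G -> nat) (f : carrier G -> nat -> nat) :
  computable n -> computable (G := ext G) (fun p => f p.1 p.2) ->
  computable (fun x => \prod_(i < n x) f x i).
Proof.
move=> cn cf.
apply: eq_computable (computable_rec cn (computable_const oracles G 1)
  (computable_mul (computable_head _ _) (computable_weak cf))) => x /=.
by elim: (n x) => /= [|m ->]; rewrite ?big_ord0 ?big_ord_recr.
Qed.

Lemma computable_exp G (f g : carrier G -> nat) :
  computable f -> computable g -> computable (fun x => f x ^ g x).
Proof.
move=> cf cg; apply: eq_computable (computable_prod (f := fun x _ => f x) cg (computable_weak cf)) => x /=.
by rewrite big_const_ord iter_muln_1.
Qed.

Lemma computable_leq G (f g : carrier G -> nat) :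
  computable f -> computable g -> computable (fun x => f x <= g x : nat).
Proof.
move=> cf cg; apply: eq_computable (computable_ifz (computable_sub cf cg)
  (computable_const _ _ 1) (computable_const _ _ 0)) => x.
by rewrite /leq; case: eqP.
Qed.

Lemma computable_ltn G (f g : carrier G -> nat) :
  computable f -> computable g -> computable (fun x => f x < g x : nat).
Proof. by move=> cf; exact/computable_leq/computable_succ. Qed.

Lemma sum_leq_ord m q : q <= m -> \sum_(i < m) (i < q : nat) = q.
Proof.
move=> qm; rewrite -(big_mkord xpredT (fun i => (i < q : nat))) (big_cat_nat (leq0n q) qm) /=.
rewrite (eq_big_nat _ _ (F2 := fun=> 1)); last by move=> i /andP[_ ->].
rewrite [X in _ + X](eq_big_nat _ _ (F2 := fun=> 0)); last first.
  by move=> i /andP[qi _]; rewrite ltnNge qi.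
by rewrite !sum_nat_const_nat; lia.
Qed.

(** The quotient of [m] by [d] is the number of [i < m] with [(i + 1) d <= m]. *)
Lemma computable_divS G (f g : carrier G -> nat) :
  computable f -> computable g -> computable (fun x => f x %/ (g x).+1).
Proof.
move=> cf cg; apply: eq_computable (computable_sum (f := fun x i => i.+1 * (g x).+1 <= f x) cf _) => [x|].
  under eq_bigr do rewrite -leq_divRL //.
  by apply: sum_leq_ord; exact: leq_div.
apply: computable_leq; last exact: computable_weak.
by apply: computable_mul; apply: computable_succ; [exact: computable_head | exact: computable_weak].
Qed.

Lemma computable_var2 G : computable (G := ext (ext (ext G))) (fun p => p.1.1.2).
Proof. exact: (computable_weak (computable_weak (computable_head _ _))). Qed.

Lemma computable_arg0 G : computable (G := ext (ext (ext (ext (ext G))))) (fun p => p.1.1.1.1.2).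
Proof. exact: (computable_subst (morphism_fst2 _ _) (computable_var2 G)). Qed.

Lemma computable_arg1 G : computable (G := ext (ext (ext (ext (ext G))))) (fun p => p.1.1.1.2).
Proof. exact: (computable_weak (computable_var2 (ext G))). Qed.

(** The quotient is the integer part of the inverse of the fraction
    [(q_0 + 1) / (q_1 + 1)]. *)
Lemma implemented_rate G (F : carrier (ext G) -> nat) : computable F ->
  implemented oracles (fun x q => F (x, (nth 0 q 1).+1 %/ (nth 0 q 0).+1)).
Proof.
move=> cF; split=> //=.
have f5 : morphism_of (G' := ext (ext (ext (ext (ext G))))) (G := G) (fun p => p.1.1.1.1.1).
  exact: (morphism_comp (morphism_fst2 _ _) (morphism_comp (morphism_fst2 _ _) (morphism_fst _ _))).
have cq : computable (G := ext (ext (ext (ext (ext G))))) (fun p => p.1.1.1.2.+1 %/ p.1.1.1.1.2.+1).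
  by apply: computable_divS (computable_arg0 G); apply: computable_succ; exact: computable_arg1.
exact: (computable_subst (morphism_pair f5 cq) cF).
Qed.

Lemma computable_modS G (f g : carrier G -> nat) :
  computable f -> computable g -> computable (fun x => f x %% (g x).+1).
Proof.
move=> cf cg; apply: eq_computable (computable_sub cf
  (computable_mul (computable_divS cf cg) (computable_succ cg))) => x.
by rewrite {1}(divn_eq (f x) (g x).+1) addKn.
Qed.

Lemma sum_bool_gt0 n (b : nat -> bool) :
  reflect (exists2 i, i < n & b i) (0 < \sum_(i < n) b i).
Proof.
apply: (iffP idP) => [|[i lin bi]]; last by rewrite (bigD1 (Ordinal lin)) //= bi.
elim: n => [|n IH]; first by rewrite big_ord0.
rewrite big_ord_recr /= addn_gt0 => /orP[/IH[i ? ?]|].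
  by exists i => //; exact: ltnW.
by case bn: (b n) => // _; exists n.
Qed.

Lemma computable_search G (P : carrier G -> nat -> bool) :
  computable (G := ext G) (fun p => P p.1 p.2 : nat) -> (forall x, exists n, P x n) ->
  exists f : carrier G -> nat, computable f /\ forall x, P x (f x).
Proof.
move=> cP exP; exists (fun x => ex_minn (exP x)); split; last by move=> x; case: ex_minnP.
exact: (computable_mu (p := fun p => P p.1 p.2) exP cP).
Qed.

(** A common bound of the two witnesses is found first, then one witness after the
    other. *)
Lemma computable_search2 G (P : carrier G -> nat -> nat -> bool) :
  computable (G := ext (ext G)) (fun p => P p.1.1 p.1.2 p.2 : nat) ->
  (forall x, exists m n, P x m n) ->
  exists f g : carrier G -> nat, [/\ computable f, computable g & forall x, P x (f x) (g x)].
Proof.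
move=> cP exP.
pose Q x s m := 0 < \sum_(n < s) P x m n.
have [S [cS SP]] : exists S : carrier G -> nat, computable S /\
    forall x, 0 < \sum_(m < S x) Q x (S x) m.
  apply: (@computable_search _ (fun x s => 0 < \sum_(m < s) Q x s m)).
    apply: computable_ltn; first exact: computable_const.
    apply: (computable_sum (f := fun (p : ext G) m => Q p.1 p.2 m)); first exact: computable_head.
    apply: computable_ltn; first exact: computable_const.
    apply: (computable_sum (f := fun (p : ext (ext G)) n => P p.1.1 p.2 n)).
      exact: (computable_weak (computable_head _ _)).
    apply: (computable_subst (s := fun p : ext (ext (ext G)) => (p.1.1.1, p.1.2, p.2) : ext (ext G))) cP.
    apply: morphism_pair (computable_head _ _).
    apply: morphism_pair (computable_weak (computable_head _ _)).
    exact: (morphism_comp (morphism_fst _ _) (morphism_fst2 _ _)).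
  move=> x; have [m [n Pmn]] := exP x; exists (maxn m n).+1.
  apply/sum_bool_gt0; exists m; first by rewrite ltnS leq_maxl.
  by apply/sum_bool_gt0; exists n; first by rewrite ltnS leq_maxr.
have [f [cf fP]] : exists f : carrier G -> nat, computable f /\
    forall x, Q x (S x) (f x).
  apply: (@computable_search _ (fun x m => Q x (S x) m)).
    apply: computable_ltn; first exact: computable_const.
    by apply: (computable_sum (f := fun (p : ext G) n => P p.1 p.2 n)) cP; exact: computable_weak.
  by move=> x; have /sum_bool_gt0[m _ ?] := SP x; exists m.
have [g [cg gP]] : exists g : carrier G -> nat, computable g /\ forall x, P x (f x) (g x).
  apply: (@computable_search _ (fun x n => P x (f x) n)).
    apply: (computable_subst (s := fun p : ext G => (p.1, f p.1, p.2) : ext (ext G))) cP.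
    apply: morphism_pair (computable_head _ _); apply: morphism_pair (computable_weak cf).
    exact: morphism_fst.
  by move=> x; have /sum_bool_gt0[n _ ?] := fP x; exists n.
by exists f, g.
Qed.

Local Open Scope ring_scope.

(** The format in which names present rationals. *)
Definition computable_rat G (f : carrier G -> rat) := exists p n d : carrier G -> nat,
  [/\ computable p, computable n, computable d &
      forall x, f x = ((p x)%:R - (n x)%:R) / (d x).+1%:R].

Lemma computable_rat_subst G' G (f : carrier G -> rat) (s : carrier G' -> carrier G) :
  morphism_of s -> computable_rat f -> computable_rat (fun y => f (s y)).
Proof.
move=> sP [p [n [d [cp cn cd fE]]]].
exists (fun y => p (s y)), (fun y => n (s y)), (fun y => d (s y)).
by split; try exact: computable_subst.
Qed.

Lemma computable_rat_natr G (f : carrier G -> nat) : computable f -> computable_rat (fun x => (f x)%:R).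
Proof.
move=> cf; exists f, (fun=> 0%N), (fun=> 0%N); split=> //; try exact: computable_const.
by move=> x; rewrite subr0 divr1.
Qed.

Lemma computable_rat_invS G (f : carrier G -> nat) : computable f -> computable_rat (fun x => (f x).+1%:R^-1).
Proof.
move=> cf; exists (fun=> 1%N), (fun=> 0%N), f; split=> //; try exact: computable_const.
by move=> x; rewrite subr0 div1r.
Qed.

Lemma computable_rat_opp G (f : carrier G -> rat) : computable_rat f -> computable_rat (fun x => - f x).
Proof.
move=> [p [n [d [cp cn cd fE]]]]; exists n, p, d; split=> // x.
by rewrite fE -mulNr opprB.
Qed.

Lemma computable_rat_add G (f g : carrier G -> rat) :
  computable_rat f -> computable_rat g -> computable_rat (fun x => f x + g x).
Proof.
move=> [p [n [d [cp cn cd fE]]]] [p' [n' [d' [cp' cn' cd' gE]]]].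
exists (fun x => p x * (d' x).+1 + p' x * (d x).+1)%N,
  (fun x => n x * (d' x).+1 + n' x * (d x).+1)%N,
  (fun x => ((d x).+1 * (d' x).+1).-1)%N.
split; try by [
  do ?[apply: computable_add|apply: computable_mul|apply: computable_pred|apply: computable_succ]].
move=> x; rewrite fE gE prednK ?muln_gt0 // !natrD !natrM.
field; by rewrite !nat1r !pnatr_eq0.
Qed.

Lemma computable_rat_mul G (f g : carrier G -> rat) :
  computable_rat f -> computable_rat g -> computable_rat (fun x => f x * g x).
Proof.
move=> [p [n [d [cp cn cd fE]]]] [p' [n' [d' [cp' cn' cd' gE]]]].
exists (fun x => p x * p' x + n x * n' x)%N,
  (fun x => p x * n' x + n x * p' x)%N,
  (fun x => ((d x).+1 * (d' x).+1).-1)%N.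
split; try by [
  do ?[apply: computable_add|apply: computable_mul|apply: computable_pred|apply: computable_succ]].
move=> x; rewrite fE gE prednK ?muln_gt0 // !natrD !natrM.
field; by rewrite !nat1r !pnatr_eq0.
Qed.

(** With the product of all denominators as common denominator, sums of naturals
    suffice, and no pairs have to be carried through a recursion. *)
Lemma computable_rat_sum G (m : carrier G -> nat) (f : carrier G -> nat -> rat) :
  computable m -> computable_rat (G := ext G) (fun p => f p.1 p.2) ->
  computable_rat (fun x => \sum_(i < m x) f x i).
Proof.
move=> cm [p [n [d [cp cn cd fE]]]].
pose e x := (\prod_(i < m x) (d (x, val i)).+1)%N.
have e_gt0 x : (0 < e x)%N by apply: prodn_gt0.
have ce : computable e.
  apply: (computable_prod (f := fun x i => (d (x, i)).+1)) => //.
  by apply: computable_succ; apply: eq_computable cd => -[].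
pose num (h : carrier (ext G) -> nat) x :=
  (\sum_(i < m x) h (x, val i) * (e x %/ (d (x, val i)).+1))%N.
have cnum h : computable h -> computable (num h).
  move=> ch; apply: (computable_sum (f := fun x i => h (x, i) * (e x %/ (d (x, i)).+1))%N) => //.
  apply: computable_mul; first by apply: eq_computable ch => -[].
  by apply: computable_divS; [exact: computable_weak | apply: eq_computable cd => -[]].
exists (num p), (num n), (fun x => (e x).-1); split; [exact: cnum|exact: cnum|exact: computable_pred|].
move=> x; rewrite prednK // -[(num p x)%:R]/(_ *+ _) /num !natr_sum -sumrB mulr_suml.
apply: eq_bigr => i _; rewrite (fE (x, val i)) !natrM -mulrBl -mulrA; congr (_ * _).
have dvd : ((d (x, val i)).+1 %| e x)%N by rewrite /e (bigD1 i) //= dvdn_mulr.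
have -> : (e x)%:R = (e x %/ (d (x, val i)).+1)%:R * (d (x, val i)).+1%:R :> rat.
  by rewrite -natrM divnK.
rewrite invfM mulrA divff ?mul1r //.
by rewrite pnatr_eq0 -lt0n divn_gt0 // dvdn_leq.
Qed.

Lemma computable_rat_lt G (f g : carrier G -> rat) :
  computable_rat f -> computable_rat g -> computable (fun x => (f x < g x)%R : nat).
Proof.
move=> [p [n [d [cp cn cd fE]]]] [p' [n' [d' [cp' cn' cd' gE]]]].
apply: (@eq_computable _ _ _ (fun x => (p x * (d' x).+1 + n' x * (d x).+1 <
   p' x * (d x).+1 + n x * (d' x).+1)%N : nat)).
  move=> x; congr (nat_of_bool _); rewrite fE gE.
  rewrite ltr_pdivrMr ?ltr0n // mulrAC ltr_pdivlMr ?ltr0n //.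
  rewrite -(ltr_nat rat) !natrD !natrM; apply/idP/idP; lra.
by apply: computable_ltn;
  do ?[apply: computable_add|apply: computable_mul|apply: computable_pred|apply: computable_succ].
Qed.

Lemma computable_rat_bound G (f : carrier G -> rat) : computable_rat f ->
  exists W : carrier G -> nat, computable W /\ forall x, `|f x| <= (W x)%:R.
Proof.
move=> [p [n [d [cp cn cd fE]]]]; exists (fun x => p x + n x)%N; split; first exact: computable_add.
move=> x; rewrite fE normrM normfV [X in _ / X]ger0_norm ?ler0n //.
rewrite ler_pdivrMr ?ltr0n // (le_trans (ler_normB _ _)) // !ger0_norm ?ler0n //.
by rewrite -!natrD -natrM ler_nat leq_pmulr.
Qed.

Section ScalarArithmetic.
Variables (R : realType) (k : scalar_kind).

Definition computable_scalar G (c : carrier G -> scalars R k) := exists a b : carrier G -> rat,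
  [/\ computable_rat a, computable_rat b & forall x, c x = rat_scalar k (a x) (b x)].

Lemma computable_scalar_subst G' G (c : carrier G -> scalars R k) (s : carrier G' -> carrier G) :
  morphism_of s -> computable_scalar c -> computable_scalar (fun y => c (s y)).
Proof.
move=> sP [a [b [ca cb cE]]]; exists (fun y => a (s y)), (fun y => b (s y)).
by split; try exact: computable_rat_subst.
Qed.

Lemma computable_scalar_natr G (f : carrier G -> nat) : computable f -> computable_scalar (fun x => (f x)%:R).
Proof.
move=> cf; exists (fun x => (f x)%:R), (fun=> 0%:R); split; try exact: computable_rat_natr.
  by apply: computable_rat_natr; exact: computable_const.
by move=> x; rewrite rat_scalar_nat.
Qed.

Lemma computable_scalar_opp G (c : carrier G -> scalars R k) :
  computable_scalar c -> computable_scalar (fun x => - c x).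
Proof.
move=> [a [b [ca cb cE]]]; exists (fun x => - a x), (fun x => - b x).
split; try exact: computable_rat_opp; by move=> x; rewrite cE rat_scalarN.
Qed.

Lemma computable_scalar_add G (c c' : carrier G -> scalars R k) :
  computable_scalar c -> computable_scalar c' -> computable_scalar (fun x => c x + c' x).
Proof.
move=> [a [b [ca cb cE]]] [a' [b' [ca' cb' cE']]].
exists (fun x => a x + a' x), (fun x => b x + b' x).
split; try exact: computable_rat_add; by move=> x; rewrite cE cE' rat_scalarD.
Qed.

Lemma computable_scalar_mul G (c c' : carrier G -> scalars R k) :
  computable_scalar c -> computable_scalar c' -> computable_scalar (fun x => c x * c' x).
Proof.
move=> [a [b [ca cb cE]]] [a' [b' [ca' cb' cE']]].
exists (fun x => mul_re k (a x) (b x) (a' x) (b' x)), (fun x => a x * b' x + b x * a' x).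
split.
- rewrite /mul_re; case: k; first exact: computable_rat_mul.
  by apply: computable_rat_add; [|apply: computable_rat_opp]; exact: computable_rat_mul.
- by apply: computable_rat_add; exact: computable_rat_mul.
- by move=> x; rewrite cE cE' rat_scalarM.
Qed.

Lemma computable_scalar_sum G (n : carrier G -> nat) (c : carrier G -> nat -> scalars R k) :
  computable n -> computable_scalar (G := ext G) (fun p => c p.1 p.2) ->
  computable_scalar (fun x => \sum_(i < n x) c x i).
Proof.
move=> cn [a [b [ca cb cE]]].
exists (fun x => \sum_(i < n x) a (x, val i)), (fun x => \sum_(i < n x) b (x, val i)); split.
- apply: (computable_rat_sum (f := fun x i => a (x, i))) => //.
  by move: ca; congr computable_rat; apply/funext => -[].
- apply: (computable_rat_sum (f := fun x i => b (x, i))) => //.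
  by move: cb; congr computable_rat; apply/funext => -[].
move=> x; elim: (n x) => [|m IH]; first by rewrite !big_ord0 -[0 in RHS]/(0%:R) rat_scalar_nat.
by rewrite !big_ord_recr /= IH (cE (x, m)) rat_scalarD.
Qed.

Lemma computable_scalar_bound G (c : carrier G -> scalars R k) : computable_scalar c ->
  exists W : carrier G -> nat, computable W /\ forall x, re `|c x| <= (W x)%:R.
Proof.
move=> [a [b [/computable_rat_bound[W [cW WP]] /computable_rat_bound[W' [cW' WP']] cE]]].
exists (fun x => W x + W' x)%N; split; first exact: computable_add.
move=> x; rewrite cE (le_trans (norm_rat_scalar _ _ _ _)) //.
by rewrite -ratr_nat ler_rat natrD lerD.
Qed.

End ScalarArithmetic.
End Arithmetic.

(** * Computable vectors *)

Section Rates.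
Variables (R : realType) (k : scalar_kind) (V : normedModType (scalars R k)).

Lemma ratr_invS n : ratr n.+1%:R^-1 = n.+1%:R^-1 :> R.
Proof. by rewrite fmorphV /= ratr_nat. Qed.

Lemma names_rate_limit (u : nat -> V) x phi : u @ \oo --> x -> names_rate u phi ->
  forall m, rnorm (x - u (phi [:: 0%N; m])) <= m.+1%:R^-1.
Proof.
move=> /cvg_rnorm ux [r [rP phir]] m; rewrite phir div1r.
have [|_ rm] := rP m.+1%:R^-1; first by rewrite invr_gt0 ltr0n.
apply/ler_addgt0Pr => eps eps0; have [j jP] := inv_nat_lt eps0.
have [N NP] := ux j; set a := r _ in rm *.
have := NP _ (leq_maxl N a); have := rm _ (leq_maxr N a).
rewrite norm_lt_rat ratr_invS; have := rnorm_tri (u (maxn N a)) x (u a).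
move: jP; set b := j.+1%:R^-1; set c := m.+1%:R^-1; lra.
Qed.

(** The integer part [j] of [1 / eps] depends only on the rational number [eps], not
    on the fraction that presents it, and [1 / (j + 1) < eps]. *)
Lemma names_rate_intro (u : nat -> V) (F : nat -> nat) (phi : name) :
  (forall j, (0 < F j)%N) ->
  (forall j m, (F j <= m)%N -> rnorm (u m - u (F j)) <= j.+1%:R^-1) ->
  (forall a b, phi [:: a; b] = F (b.+1 %/ a.+1)%N) ->
  names_rate u phi.
Proof.
move=> F0 FP phiF; exists (fun q => F (`|denq q| %/ `|numq q|)%N); split.
  move=> q q0; split=> // m /FP; rewrite norm_lt_rat => /le_lt_trans; apply.
  rewrite -ratr_invS ltr_rat.
  have n0 : (0 < `|numq q|)%N by rewrite absz_gt0 numq_eq0 gt_eqF.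
  have d0 : (0 < `|denq q|)%N by rewrite absz_gt0 denq_eq0.
  rewrite -[ltRHS]divq_num_den -(gtz0_abs (denq_gt0 q)) -(@gtz0_abs (numq q)) ?numq_gt0 //.
  rewrite -!pmulrn -[ltRHS]invf_div ltf_pV2 ?posrE ?divr_gt0 ?ltr0n // ltr_pdivrMr ?ltr0n //.
  by rewrite -natrM ltr_nat; apply: ltn_ceil.
move=> a b; rewrite phiF; congr F; set q := _ / _.
have q0 : 0 < q by rewrite divr_gt0 ?ltr0n.
have n0 : (0 < `|numq q|)%N by rewrite absz_gt0 numq_eq0 gt_eqF.
have : (a.+1 * `|denq q| = `|numq q| * b.+1)%N.
  apply/eqP; rewrite -(eqr_nat rat) !natrM.
  have e1 : (`|denq q|%N%:R : rat) = (denq q)%:~R by rewrite pmulrn gtz0_abs ?denq_gt0.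
  have e2 : (`|numq q|%N%:R : rat) = (numq q)%:~R by rewrite pmulrn gtz0_abs ?numq_gt0.
  rewrite e1 e2 -eqr_div ?pnatr_eq0 ?intr_eq0 ?denq_eq0 //.
  by rewrite divq_num_den.
move=> cross; rewrite -(@divnMr `|numq q|%N b.+1) // -(@divnMr a.+1 `|denq q|%N) //.
by congr (_ %/ _)%N; lia.
Qed.

End Rates.

Lemma sum_truncated (K : pzRingType) (V : lmodType K) (e : nat -> V) (c : nat -> K) l L :
  (l <= L)%N ->
  \sum_(i < L) ((i < l)%N%:R * c i) *: e i = \sum_(i < l) c i *: e i.
Proof.
move=> lL; rewrite -(big_mkord xpredT (fun i => ((i < l)%N%:R * c i) *: e i)).
rewrite (big_cat_nat (leq0n l) lL) /= [X in _ + X]big1_seq ?addr0.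
  by rewrite big_mkord; apply: eq_bigr => i _; rewrite ltn_ord mul1r.
move=> i /andP[_]; rewrite mem_index_iota => /andP[li _].
by rewrite ltnNge li mul0r scale0r.
Qed.

Section Vectors.
Variables (D : Type) (oracles : D -> seq name).
Notation context := (context D).
Notation computable := (computable oracles).
Notation computable_name := (computable_name oracles).
Notation computable_rat := (computable_rat oracles).
Notation computable_scalar := (computable_scalar oracles).
Notation implemented := (implemented oracles).
Notation morphism_of := (morphism_of oracles).
Variables (R : realType) (k : scalar_kind) (H : normedModType (scalars R k)).
Variable e : nat -> H.
Implicit Type G : context.

(** This is a vector with a name, except that the rate of convergence is fixed; it
    is equivalent to the existence of a computable name by
    [computable_vector_name] and [implemented_vector_name]. *)
Definition computable_vector G (v : carrier G -> H) :=
  exists (len : carrier G -> nat -> nat) (c : carrier G -> nat -> nat -> scalars R k),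
  [/\ computable (G := ext G) (fun p => len p.1 p.2),
      computable_scalar (G := ext (ext G)) (fun p => c p.1.1 p.1.2 p.2) &
      forall x m, rnorm (v x - \sum_(i < len x m) c x m i *: e i) <= m.+1%:R^-1].

Lemma computable_vector_basis G (f : carrier G -> nat) :
  computable f -> computable_vector (fun x => e (f x)).
Proof.
move=> cf; exists (fun x _ => (f x).+1), (fun x _ i => (f x <= i)%N%:R); split.
- by apply: computable_succ; exact: (computable_weak cf).
- apply: computable_scalar_natr; apply: computable_leq (computable_head _ _).
  exact: (computable_weak (computable_weak cf)).
move=> x m; rewrite big_ord_recr /= leqnn scale1r big1 ?add0r ?subrr ?rnorm0 ?invr_ge0 ?ler0n //.
by move=> i _; rewrite leqNgt ltn_ord scale0r.
Qed.

(** Two errors at precision [2 m + 1] add up to one at precision [m]. *)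
Lemma half_precision m : (2 * m).+2%:R^-1 + (2 * m).+2%:R^-1 = m.+1%:R^-1 :> R.
Proof.
have -> : (2 * m).+2 = (2 * m.+1)%N by lia.
by rewrite natrM; field; rewrite nat1r pnatr_eq0.
Qed.

Lemma computable_double G (f : carrier G -> nat) :
  computable f -> computable (fun x => (2 * f x).+1%N).
Proof. by move=> cf; apply: computable_succ; apply: computable_mul => //; exact: computable_const. Qed.

Lemma computable_vector_sub G (v w : carrier G -> H) :
  computable_vector v -> computable_vector w -> computable_vector (fun x => v x - w x).
Proof.
move=> [lv [cv [clv ccv vP]]] [lw [cw [clw ccw wP]]].
pose s m := (2 * m).+1%N.
exists (fun x m => lv x (s m) + lw x (s m))%N,
  (fun x m i => (i < lv x (s m))%N%:R * cv x (s m) i - (i < lw x (s m))%N%:R * cw x (s m) i).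
have s1 : morphism_of (G' := ext G) (G := ext G) (fun p => (p.1, s p.2)).
  apply: morphism_pair; first exact: morphism_fst.
  by apply: computable_double; exact: computable_head.
split.
- by apply: computable_add; [exact: (computable_subst s1 clv)|exact: (computable_subst s1 clw)].
- apply: computable_scalar_add; [|apply: computable_scalar_opp]; apply: computable_scalar_mul.
  + apply: computable_scalar_natr; apply: computable_ltn (computable_head _ _) _.
    exact: (computable_weak (computable_subst s1 clv)).
  + exact: (computable_scalar_subst (morphism_lift s1) ccv).
  + apply: computable_scalar_natr; apply: computable_ltn (computable_head _ _) _.
    exact: (computable_weak (computable_subst s1 clw)).
  + exact: (computable_scalar_subst (morphism_lift s1) ccw).
move=> x m; under eq_bigr do rewrite scalerBl.
rewrite sumrB !sum_truncated ?leq_addr ?leq_addl // -half_precision.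
set a := \sum_(i < _) _; set b := \sum_(i < _) _.
have -> : v x - w x - (a - b) = v x - a - (w x - b).
  by rewrite !opprB addrACA [RHS]addrACA; congr (_ + _); exact: addrC.
by apply: (le_trans (rnormB _ _)); apply: lerD; [exact: vP | exact: wP].
Qed.

(** If [w] bounds the sum of the norms of the coefficients, it suffices to know the
    vectors up to [1 / ((w + 1) (m + 1))]. Their approximations have different
    lengths and are padded with zeros to the sum of all lengths. *)
Lemma computable_vector_comb G (n : carrier G -> nat) (c : carrier G -> nat -> scalars R k)
    (v : carrier G -> nat -> H) :
  computable n -> computable_scalar (G := ext G) (fun p => c p.1 p.2) ->
  computable_vector (G := ext G) (fun p => v p.1 p.2) ->
  computable_vector (fun x => \sum_(j < n x) c x j *: v x j).
Proof.
move=> cn cc [len [a [clen ca vP]]].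
have [W [cW WP]] := computable_scalar_bound cc.
pose w x := (\sum_(j < n x) W (x, val j))%N.
have cw : computable w.
  by apply: (computable_sum (f := fun x j => W (x, j))) => //; apply: eq_computable cW => -[].
pose s x m := ((w x).+1 * m.+1).-1%N.
have cs : computable (G := ext G) (fun p => s p.1 p.2).
  apply: computable_pred; apply: computable_mul; apply: computable_succ; last exact: computable_head.
  exact: computable_weak cw.
exists (fun x m => \sum_(j < n x) len (x, val j) (s x m))%N,
  (fun x m i => \sum_(j < n x) c x j * ((i < len (x, val j) (s x m))%N%:R * a (x, val j) (s x m) i)).
split.
- apply: (computable_sum (G := ext G) (f := fun p j => len (p.1, j) (s p.1 p.2))).
    exact: computable_weak cn.
  apply: (computable_subst (G := ext (ext G))
    (s := fun p : ext (ext G) => (p.1.1, p.2, s p.1.1 p.1.2))) clen.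
  apply: morphism_pair; last exact: computable_weak cs.
  by apply: morphism_lift; exact: morphism_fst.
- apply: (computable_scalar_sum (G := ext (ext G)) (c := fun p j => c p.1.1 j *
     ((p.2 < len (p.1.1, j) (s p.1.1 p.1.2))%N%:R * a (p.1.1, j) (s p.1.1 p.1.2) p.2))).
    exact: computable_weak (computable_weak cn).
  have sm : morphism_of (G' := ext (ext (ext G))) (G := ext (ext G))
      (fun p => (p.1.1.1, p.2, s p.1.1.1 p.1.1.2)).
    apply: morphism_pair; first exact: (morphism_lift (morphism_fst2 _ _)).
    exact: (computable_weak (computable_weak cs)).
  apply: computable_scalar_mul.
    exact: (computable_scalar_subst (morphism_lift (morphism_fst2 _ _)) cc).
  apply: computable_scalar_mul.
    apply: computable_scalar_natr; apply: computable_ltn.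
      exact: (computable_weak (computable_head _ _)).
    exact: (computable_subst sm clen).
  apply: (computable_scalar_subst _ ca (s := fun p : ext (ext (ext G)) =>
    (p.1.1.1, p.2, s p.1.1.1 p.1.1.2, p.1.2) : ext (ext (ext G)))).
  by apply: morphism_pair sm _; exact: (computable_weak (computable_head _ _)).
move=> x m.
under [X in _ - X]eq_bigr do rewrite scaler_suml.
rewrite exchange_big /= -sumrB.
pose err j := v x j - \sum_(i < len (x, j) (s x m)) a (x, j) (s x m) i *: e i.
rewrite (eq_bigr (fun j => c x (val j) *: err (val j))); last first.
  move=> j _; rewrite /err scalerBr; congr (_ - _).
  under eq_bigr do rewrite -scalerA.
  rewrite -scaler_sumr sum_truncated //.
  by rewrite (bigD1 j) //= leq_addr.
apply: (le_trans (rnorm_sum _ (fun j => c x j *: err j))).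
apply: (@le_trans _ _ ((w x)%:R * (s x m).+1%:R^-1)).
  rewrite /w natr_sum mulr_suml; apply: ler_sum => j _.
  rewrite rnormZ; apply: ler_pM; rewrite ?rnorm_ge0 //.
  - exact: (WP (x, val j)).
  - exact: (vP (x, val j)).
rewrite /s prednK ?muln_gt0 // natrM invfM mulrA ger_pMl ?invr_gt0 ?ltr0n //.
by rewrite ler_pdivrMr ?ltr0n // mul1r ler_nat.
Qed.

Lemma computable_vector_limit G (v : carrier G -> H) (w : carrier G -> nat -> H) :
  computable_vector (G := ext G) (fun p => w p.1 p.2) ->
  (forall x m, rnorm (v x - w x m) <= m.+1%:R^-1) -> computable_vector v.
Proof.
move=> [len [c [clen cc wP]]] vw; pose s m := (2 * m).+1%N.
exists (fun x m => len (x, s m) (s m)), (fun x m i => c (x, s m) (s m) i).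
have sm : morphism_of (G' := ext G) (G := ext (ext G)) (fun p => (p.1, s p.2, s p.2)).
  by do ?[apply: morphism_pair|apply: computable_double|apply: morphism_fst|apply: computable_head].
split.
- exact: (computable_subst sm clen).
- exact: (computable_scalar_subst (morphism_lift sm) cc).
move=> x m; rewrite -half_precision.
apply: (le_trans (rnorm_tri (w x (s m)) _ _)); apply: lerD; first exact: vw.
exact: (wP (x, s m)).
Qed.

Lemma computable_rat_at G (phi : carrier G -> name) (fs : seq (carrier G -> nat)) :
  computable_name phi -> computables oracles fs ->
  computable_rat (fun x => rat_at (phi x) [seq f x | f <- fs]).
Proof.
move=> cphi cfs.
have c i : computable (fun x => phi x (i :: [seq f x | f <- fs])).
  by apply: (computable_name_app (fs := (fun=> i) :: fs) cphi); split=> //; exact: computable_const.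
by exists (fun x => phi x (0%N :: [seq f x | f <- fs])), (fun x => phi x (1%N :: [seq f x | f <- fs])),
  (fun x => phi x (2%N :: [seq f x | f <- fs])).
Qed.

Lemma computable_vector_name G (v : carrier G -> H) (phi : carrier G -> name) :
  computable_name phi -> (forall x, names_vector e (v x) (phi x)) -> computable_vector v.
Proof.
move=> cphi vphi.
pose r x m := phi x [:: 1%N; 0%N; m].
exists (fun x m => phi x [:: 2%N; r x m]),
  (fun x m i => scalar_at k (subname (phi x) 0) [:: r x m; i]).
have cphi1 : computable_name (G := ext G) (fun p => phi p.1).
  exact: (computable_name_subst (morphism_fst _ _) cphi).
have cphi2 : computable_name (G := ext (ext G)) (fun p => phi p.1.1).
  exact: (computable_name_subst (morphism_fst _ _) cphi1).
have cr : computable (G := ext G) (fun p => r p.1 p.2).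
  apply: (computable_name_app (G := ext G) (fs := [:: fun=> 1%N; fun=> 0%N; fun p => p.2]) cphi1).
  by do !split; try exact: computable_const; exact: computable_head.
split.
- apply: (computable_name_app (G := ext G) (fs := [:: fun=> 2%N; fun p => r p.1 p.2]) cphi1).
  by do !split; first exact: computable_const.
- have cc : forall o, computable_rat (G := ext (ext G)) (fun p =>
      rat_at (subname (subname (phi p.1.1) 0) o) [:: r p.1.1 p.1.2; p.2]).
    move=> o; apply: (computable_rat_at (G := ext (ext G))
      (phi := fun p => subname (subname (phi p.1.1) 0) o)
      (fs := [:: fun p => r p.1.1 p.1.2; fun p => p.2])).
      apply: computable_name_subname (computable_const _ _ o).
      by apply: computable_name_subname (computable_const _ _ 0).
    by do !split; [exact: (computable_weak cr) | exact: computable_head].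
  by exists (fun p => rat_at (subname (subname (phi p.1.1) 0) 0) [:: r p.1.1 p.1.2; p.2]),
    (fun p => rat_at (subname (subname (phi p.1.1) 0) 1) [:: r p.1.1 p.1.2; p.2]).
by move=> x m; have [uv ru] := vphi x; exact: (names_rate_limit uv ru m).
Qed.

(** The approximations with indices at least [2 j + 1] are pairwise within
    [1 / (j + 1)]. *)
Lemma implemented_vector_name G (v : carrier G -> H) : computable_vector v ->
  exists2 phi : carrier G -> name, implemented phi & forall x, names_vector e (v x) (phi x).
Proof.
move=> [len [c [clen [a [b [[pa [na [da [cpa cna cda aE]]]] [pb [nb [db [cpb cnb cdb bE]]]] cE]]] vP]]].
pose branch (p n d : carrier (ext (ext G)) -> nat) x (q : seq nat) : nat :=
  if nth 0%N q 2 == 0%N then p (x, nth 0%N q 3, nth 0%N q 4)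
  else if (nth 0%N q 2).-1 == 0%N then n (x, nth 0%N q 3, nth 0%N q 4)
  else d (x, nth 0%N q 3, nth 0%N q 4).
pose phi x (q : seq nat) : nat :=
  if nth 0%N q 0 == 0%N then
    if nth 0%N q 1 == 0%N then branch pa na da x q else branch pb nb db x q
  else if (nth 0%N q 0).-1 == 0%N then (2 * ((nth 0%N q 2).+1 %/ (nth 0%N q 1).+1)).+1%N
  else len x (nth 0%N q 1).
exists phi.
  split=> //.
  pose G5 := ext (ext (ext (ext (ext G)))).
  have f3 : morphism_of (G' := ext (ext (ext G))) (G := G) (fun p => p.1.1.1).
    exact: (morphism_comp (morphism_fst _ _) (morphism_fst2 _ _)).
  have f4 : morphism_of (G' := ext (ext (ext (ext G)))) (G := G) (fun p => p.1.1.1.1).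
    exact: (morphism_comp (morphism_fst2 _ _) (morphism_fst2 _ _)).
  have v0 : computable (G := G5) (fun p => p.2) by exact: computable_head.
  have v2 : computable (G := G5) (fun p => p.1.1.2) by exact: computable_var2.
  have v3 : computable (G := G5) (fun p => p.1.1.1.2) by exact: computable_arg1.
  have v4 : computable (G := G5) (fun p => p.1.1.1.1.2) by exact: computable_arg0.
  have arg : forall h : carrier (ext (ext G)) -> nat, computable h ->
      computable (G := G5) (fun p => h (p.1.1.1.1.1, p.1.2, p.2)).
    by move=> h ch; exact: (computable_subst (morphism_lift (morphism_lift f3)) ch).
  have cbranch : forall p n d, computable p -> computable n -> computable d ->
      computable (G := G5) (fun y => branch p n d y.1.1.1.1.1
        [:: y.1.1.1.1.2; y.1.1.1.2; y.1.1.2; y.1.2; y.2]).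
    move=> p n d cp cn cd; apply: computable_ifz => //; first exact: arg.
    by apply: computable_ifz; [exact: computable_pred | exact: arg | exact: arg].
  apply: computable_ifz => //.
    by apply: computable_ifz => //; exact: cbranch.
  apply: computable_ifz; first exact: computable_pred.
    by apply: computable_double; apply: computable_divS => //; exact: computable_succ.
  apply: (computable_subst (G := ext G) (s := fun y : G5 => (y.1.1.1.1.1, y.1.1.1.2))) clen.
  apply: morphism_pair v3; exact: (morphism_comp (morphism_fst _ _) f4).
move=> x; pose u m := \sum_(i < len x m) c x m i *: e i.
have uE : u = fun m => \sum_(i < phi x [:: 2%N; m])
    (scalar_at k (subname (phi x) 0) [:: m; val i] : scalars R k) *: e i.
  apply/funext => m; apply: eq_bigr => i _; congr (_ *: _).
  by rewrite (cE (x, m, val i)) (aE (x, m, val i)) (bE (x, m, val i)).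
suff main : u @ \oo --> v x /\ names_rate u (subname (phi x) 1).
  by rewrite uE in main.
split.
  apply/cvg_rnorm => m; exists m => n mn; apply: le_trans (vP x n) _.
  by rewrite lef_pV2 ?posrE ?ltr0n // ler_nat.
apply: (names_rate_intro (F := fun j => (2 * j).+1)) => // j m jm.
rewrite -half_precision; apply: (le_trans (rnorm_tri (v x) _ _)).
rewrite rnorm_distC; apply: lerD; last exact: vP.
apply: le_trans (vP x m) _.
by rewrite lef_pV2 ?posrE ?ltr0n // ler_nat.
Qed.

Lemma computable_real_name G (x : carrier G -> scalars R k) (psi : carrier G -> name) :
  computable_name psi -> (forall a, x a \is Num.real) ->
  (forall a, names_real (x a) (psi a)) ->
  exists2 u : carrier G -> nat -> rat, computable_rat (G := ext G) (fun p => u p.1 p.2) &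
    forall a m, `|re (x a) - ratr (u a m)| <= m.+1%:R^-1.
Proof.
move=> cpsi xreal psix.
exists (fun a m => rat_at (subname (psi a) 0) [:: psi a [:: 1%N; 0%N; m]]).
  have cpsi1 : computable_name (G := ext G) (fun p => psi p.1).
    exact: (computable_name_subst (morphism_fst _ _) cpsi).
  apply: (computable_rat_at (G := ext G) (phi := fun p => subname (psi p.1) 0)
    (fs := [:: fun p => psi p.1 [:: 1%N; 0%N; p.2]])).
    exact: computable_name_subname (computable_const _ _ 0).
  split=> //;
  apply: (computable_name_app (G := ext G) (fs := [:: fun=> 1%N; fun=> 0%N; fun p => p.2]) cpsi1).
  by do !split; try exact: computable_const; exact: computable_head.
move=> a m; have [ux rx] := psix a; have := names_rate_limit ux rx m.
rewrite /rnorm re_norm_real; last by rewrite rpredB // ratr_real.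
by rewrite reD reN re_rat.
Qed.

Lemma computable_vector_norm G (v : carrier G -> H) :
  computable_norm e -> computable_vector v ->
  exists2 u : carrier G -> nat -> rat, computable_rat (G := ext G) (fun p => u p.1 p.2) &
    forall x m, `|rnorm (v x) - ratr (u x m)| <= m.+1%:R^-1.
Proof.
move=> [P PP] /implemented_vector_name[phi iphi vphi].
have {PP} PP x := PP _ _ (vphi x).
pose psi x := projT1 (cid (PP x)).
have psiP x : computes P [:: phi x] (psi x) /\ names_real `|v x| (psi x).
  exact: (projT2 (cid (PP x))).
have cpsi : computable_name psi.
  by apply: (computable_name_run (P := P) iphi) => x; case: (psiP x).
apply: (computable_real_name cpsi); first by move=> x; exact: normr_real.
by move=> x; case: (psiP x).
Qed.

End Vectors.

(** * Codes of rational combinations *)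

Section Codes.
Variables (R : realType) (k : scalar_kind).

Definition digit (b x t : nat) : nat := (x %/ b.+1 ^ t %% b.+1)%N.

Lemma digits_exist b (u : nat -> nat) n : (forall t, (u t <= b)%N) ->
  exists x, forall t, (t < n)%N -> digit b x t = u t.
Proof.
move=> ub; elim: n u ub => [|n IH] u ub; first by exists 0%N.
have [x xP] := IH (fun t => u t.+1) (fun t => ub t.+1).
exists (x * b.+1 + u 0)%N => -[_|t].
  by rewrite /digit expn0 divn1 modnMDl modn_small // ltnS.
rewrite ltnS => /xP <-; rewrite /digit expnS divnMA divnMDl //.
by rewrite (divn_small (_ : u 0 < b.+1)%N) ?addn0 // ltnS.
Qed.

Definition scalar_of_digits (w : nat -> nat) : scalars R k :=
  rat_scalar k (((w 0%N)%:R - (w 1%N)%:R) / (w 2%N).+1%:R)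
               (((w 3%N)%:R - (w 4%N)%:R) / (w 5%N).+1%:R).

Lemma scalar_of_digits0 : scalar_of_digits (fun=> 0%N) = 0.
Proof. by rewrite /scalar_of_digits subrr mul0r -[0]/(0%:R) rat_scalar_nat. Qed.

Lemma rat_fraction (a : rat) : exists p n d : nat, a = (p%:R - n%:R) / d.+1%:R.
Proof.
have dE : (denq a)%:~R = `|denq a|%N.-1.+1%:R :> rat.
  by rewrite prednK ?absz_gt0 ?denq_neq0 // pmulrn gtz0_abs ?denq_gt0.
have aE := divq_num_den a; rewrite dE in aE.
case: (intP (numq a)) aE => [|m|m] aE.
- by exists 0%N, 0%N, (`|denq a|%N.-1); rewrite -[LHS]aE subrr.
- by exists m.+1, 0%N, (`|denq a|%N.-1); rewrite -[LHS]aE subr0 -pmulrn.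
- exists 0%N, m.+1, (`|denq a|%N.-1); rewrite -[LHS]aE sub0r.
  by rewrite rmorphN /= -pmulrn.
Qed.

Lemma digits_dense (c : scalars R k) (eps : R) : 0 < eps ->
  exists w : nat -> nat, re `|c - scalar_of_digits w| < eps.
Proof.
move=> eps0; have [a [b abP]] := rat_scalar_dense c eps0.
have [p [n [d aE]]] := rat_fraction a; have [p' [n' [d' bE]]] := rat_fraction b.
exists (nth 0%N [:: p; n; d; p'; n'; d']).
by rewrite /scalar_of_digits /= -aE -bE.
Qed.

(** Six digits of [x] in base [b + 1] describe one coefficient. The number [b] is
    also the length of the combination: a length greater than needed does no harm,
    since the digits beyond the intended ones can be 0, and zeros describe the
    coefficient 0. *)
Definition code_coef (b x j : nat) : scalars R k :=
  scalar_of_digits (fun i => digit b x (6 * j + i)).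

Variables (H : normedModType (scalars R k)) (e : nat -> H).

Definition code_vector (b x : nat) : H := \sum_(j < b) code_coef b x j *: e j.

Lemma code_vector_dense : is_basis e ->
  forall (h : H) (eps : R), 0 < eps -> exists b x, rnorm (h - code_vector b x) < eps.
Proof.
move=> [_ _ dens] h eps eps0.
have eps2 : 0 < eps / 2 by lra.
have [m mP] := inv_nat_lt eps2.
pose r : scalars R k := ratr m.+1%:R^-1.
have [|y [hy [n [c yE]]]] := dens (ball h r) _ (ball_open h r).
  by exists h; apply: ballxx; rewrite ltr0q invr_gt0 ltr0n.
have {}hy : rnorm (h - y) < eps / 2.
  apply: lt_trans mP; move: hy; rewrite -ball_normE /= norm_lt_rat.
  by rewrite ratr_invS.
pose s := \sum_(i < n) rnorm (e i).
have s0 : 0 <= s by apply: sumr_ge0 => i _; exact: rnorm_ge0.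
have d0 : 0 < eps / 2 / (s + 1) by apply: divr_gt0 => //; lra.
pose w j := projT1 (cid (digits_dense (c j) d0)).
have wP j : re `|c j - scalar_of_digits (w j)| < eps / 2 / (s + 1).
  exact: (projT2 (cid (digits_dense (c j) d0))).
pose u t := if (t %/ 6 < n)%N then w (t %/ 6)%N (t %% 6)%N else 0%N.
(* [b] has to bound the number of coefficients and all digits. *)
pose b := (n + \sum_(t < 6 * n) u t)%N.
have ub t : (u t <= b)%N.
  have [tn|nt] := ltnP t (6 * n); last by rewrite /u ltnNge leq_divRL // (mulnC n) nt.
  by rewrite /b (bigD1 (Ordinal tn)) //= addnCA leq_addr.
have [x xP] := digits_exist (6 * b) ub.
exists b, x.
have coefE j : (j < b)%N -> code_coef b x j = (j < n)%N%:R * scalar_of_digits (w j).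
  move=> jb; have dig i : (i < 6)%N -> digit b x (6 * j + i) = if (j < n)%N then w j i else 0%N.
    move=> i6; rewrite xP; last by lia.
    by rewrite /u mulnC divnMDl // divn_small // addn0 modnMDl modn_small.
  rewrite /code_coef /scalar_of_digits !dig //; case: (j < n)%N; first by rewrite mul1r.
  by rewrite [RHS]mul0r; exact: scalar_of_digits0.
have codeE : code_vector b x = \sum_(j < n) scalar_of_digits (w j) *: e j.
  rewrite -(@sum_truncated _ _ e (fun j => scalar_of_digits (w j)) n b) ?leq_addr //.
  by apply: eq_bigr => j _; rewrite coefE.
have yc : rnorm (y - code_vector b x) <= eps / 2.
  rewrite yE codeE -sumrB; under eq_bigr do rewrite -scalerBl.
  apply: (le_trans (rnorm_sum _ (fun j => (c j - scalar_of_digits (w j)) *: e j))).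
  apply: (@le_trans _ _ (eps / 2 / (s + 1) * s)).
    rewrite /s mulr_sumr; apply: ler_sum => j _; rewrite rnormZ ler_wpM2r ?rnorm_ge0 //.
    exact: ltW.
  rewrite mulrAC ler_pdivrMr; last by lra.
  by rewrite ler_wpM2l //; lra.
by have := rnorm_tri y h (code_vector b x); lra.
Qed.

End Codes.

(** * The search *)

Section Algorithm.
Variables (R : realType) (k : scalar_kind).
Variables (H : completeNormedModType (scalars R k)) (ip : {dot H for @conj_scalar R k}).
Variable (e : nat -> H).
Hypothesis ip_norm : induces_norm ip.
Hypothesis e_basis : is_basis e.
Hypothesis e_norm : computable_norm e.

(** The data in which the two programs have to be uniform. *)
Record problem := Problem {
  operator : {linear H -> H};
  element : H;
  element_name : name;
  operator_name : name;
  norm_name : name;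
  operator_nonexpansive : nonexpansive operator;
  element_nameP : names_vector e element element_name;
  operator_nameP : names_operator e operator operator_name;
  norm_nameP : names_real `|limn (ergodic_average operator element)| norm_name
}.

Definition oracles (d : problem) : seq name :=
  [:: element_name d; operator_name d; norm_name d].

Notation context := (context problem).
Notation computable := (computable oracles).
Notation computable_name := (computable_name oracles).
Notation computable_rat := (computable_rat oracles).
Notation computable_scalar := (computable_scalar oracles).
Notation implemented := (implemented oracles).
Notation morphism_of := (morphism_of oracles).
Notation computable_vector := (computable_vector oracles e).
Notation base := (base_context problem).
Implicit Type G : context.

Definition fstar (d : problem) : H := limn (ergodic_average (operator d) (element d)).

Definition coset_vector (d : problem) (b x : nat) : H :=
  element d - coboundary (operator d) (code_vector e b x).

Lemma computable_code_coef G (b x j : carrier G -> nat) :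
  computable b -> computable x -> computable j ->
  computable_scalar (fun y => code_coef R k (b y) (x y) (j y)).
Proof.
move=> cb cx cj.
pose d i y := digit (b y) (x y) (6 * j y + i).
have cd i : computable (d i).
  apply: computable_modS => //; apply: eq_computable (computable_divS cx
    (computable_pred (computable_exp (computable_succ cb)
    (computable_add (computable_mul (computable_const _ _ 6) cj) (computable_const _ _ i))))) => y.
  by rewrite /= prednK // expn_gt0.
exists (fun y => ((d 0%N y)%:R - (d 1%N y)%:R) / (d 2%N y).+1%:R),
  (fun y => ((d 3%N y)%:R - (d 4%N y)%:R) / (d 5%N y).+1%:R).
by split=> //; [exists (d 0%N), (d 1%N), (d 2%N) | exists (d 3%N), (d 4%N), (d 5%N)].
Qed.

Lemma computable_code_vector G (b x : carrier G -> nat) :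
  computable b -> computable x -> computable_vector (fun y => code_vector e (b y) (x y)).
Proof.
move=> cb cx.
apply: (computable_vector_comb (c := fun y j => code_coef R k (b y) (x y) j) (v := fun _ j => e j)) => //.
  by apply: computable_code_coef (computable_head _ _); exact: computable_weak.
by apply: computable_vector_basis; exact: computable_head.
Qed.

Lemma computable_element G : computable_vector (G := G) (fun y => element (datum y)).
Proof.
have cname : computable_name (fun y : G => element_name (datum y)).
  exact: (@computable_name_ask _ oracles G 0).
by apply: (computable_vector_name cname) => y; exact: element_nameP.
Qed.

Lemma computable_operator_basis G (j : carrier G -> nat) : computable j ->
  computable_vector (G := G) (fun y => operator (datum y) (e (j y))).
Proof.
move=> cj; have cname : computable_name (fun y : G => operator_name (datum y)).
  exact: (@computable_name_ask _ oracles G 1).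
by apply: (computable_vector_name (computable_name_subname cname cj)) => y; exact: operator_nameP.
Qed.

Lemma computable_coset_vector G (b x : carrier G -> nat) :
  computable b -> computable x ->
  computable_vector (fun y => coset_vector (datum y) (b y) (x y)).
Proof.
move=> cb cx.
have -> : (fun y => coset_vector (datum y) (b y) (x y)) = fun y => element (datum y) -
    \sum_(j < b y) code_coef R k (b y) (x y) j *: (e j - operator (datum y) (e j)).
  apply/funext => y; rewrite /coset_vector /coboundary /code_vector; congr (_ - _).
  rewrite raddf_sum -sumrB; apply: eq_bigr => j _.
  by rewrite scalerBr; congr (_ - _); exact: linearZ.
apply: computable_vector_sub; first exact: computable_element.
apply: (computable_vector_comb (c := fun y j => code_coef R k (b y) (x y) j)
  (v := fun y j => e j - operator (datum y) (e j))) => //.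
  by apply: computable_code_coef (computable_head _ _); exact: computable_weak.
apply: computable_vector_sub; first by apply: computable_vector_basis; exact: computable_head.
apply: (computable_operator_basis (G := ext G)); exact: computable_head.
Qed.

(** [M] is a known bound of the unknown [N] and [5 eta] the excess of norm that the
    search cannot rule out; the choice of [eta] makes the excess of the square at
    most [d ^+ 2 / 4]. *)
Lemma coset_norm_bound (N M x eta d : R) : 0 <= N -> N <= M -> 0 <= x ->
  0 < eta -> eta <= 1 -> eta * (20 * (2 * M + 5)) = d ^+ 2 -> x <= N + 5 * eta ->
  x ^+ 2 <= N ^+ 2 + d ^+ 2 / 4.
Proof.
move=> N0 NM x0 eta0 eta1 <- xN.
apply: (@le_trans _ _ ((N + 5 * eta) ^+ 2)); first by rewrite ler_pXn2r ?nnegrE //; lra.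
nra.
Qed.

(** Both norms are known up to [eta] only. The test [u < ustar + 3 eta] between
    their approximations succeeds when the norm of the coset vector exceeds that
    of the limit by less than [eta], and its success bounds the excess by
    [5 eta]. *)
Lemma computable_coset_search : exists b x : carrier (ext base) -> nat,
  [/\ computable b, computable x & forall y : ext base,
    rnorm (coset_vector y.1 (b y) (x y)) ^+ 2 <=
      rnorm (fstar y.1) ^+ 2 + (y.2.+1%:R^-1) ^+ 2 / 4].
Proof.
have cname : computable_name (fun d : base => norm_name d).
  exact: (@computable_name_ask _ oracles base 2).
have [ustar custar ustarP] := computable_real_name cname
  (fun d => normr_real (fstar d)) (fun d => norm_nameP d).
have [W [cW WP]] := computable_rat_bound (computable_rat_subst
  (morphism_pair (morphism_id oracles base) (computable_const _ _ 0)) custar).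
pose M d := (W d).+1.
have MP d : rnorm (fstar d) <= (M d)%:R.
  have := ustarP d 0%N; have := WP d; rewrite /= -(ler_rat R) ratr_norm ratr_nat.
  rewrite invr1 -natr1 -/(rnorm (fstar d)) => H1 H2.
  have := ler_norm (rnorm (fstar d) - ratr (ustar d 0)).
  have := ler_norm (ratr (ustar d 0) : R); lra.
(* The index of the precision [eta] that [coset_norm_bound] asks for. *)
pose prec (y : ext base) := (20 * (2 * M y.1 + 5) * y.2.+1 ^ 2).-1%N.
have precE (y : ext base) : (prec y).+1%:R^-1 * (20 * (2 * (M y.1)%:R + 5)) = y.2.+1%:R^-1 ^+ 2 :> R.
  rewrite /prec prednK ?muln_gt0 ?expn_gt0 ?addn_gt0 ?orbT //.
  rewrite !natrM natrD natrM; field.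
  by rewrite nat1r pnatr_eq0 /= -!natrM -natrD pnatr_eq0 addn_eq0 andbF.
have cprec : computable (G := ext base) prec.
  apply: computable_pred; apply: computable_mul.
    apply: computable_mul; first exact: computable_const.
    apply: computable_add (computable_const _ _ 5); apply: computable_mul; first exact: computable_const.
    by apply: (computable_weak (G := base) (f := fun d => M d)); exact: computable_succ.
  by apply: computable_exp (computable_const _ _ 2); apply: computable_succ; exact: computable_head.
pose G3 := ext (ext (ext base)).
have cb : computable (G := G3) (fun p => p.1.2) by exact: (computable_weak (computable_head _ _)).
have cx : computable (G := G3) (fun p => p.2) by exact: computable_head.
have [u cu uP] := computable_vector_norm e_norm (computable_coset_vector cb cx).
pose test (y : ext base) b x :=
  u (y, b, x) (prec y) < ustar y.1 (prec y) + 3%:R * (prec y).+1%:R^-1.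
have f2 : morphism_of (G' := G3) (G := ext base) (fun p => p.1.1) by exact: morphism_fst2.
have cprec3 : computable (G := G3) (fun p => prec p.1.1) by exact: (computable_subst f2 cprec).
have ctest : computable (G := G3) (fun p => test p.1.1 p.1.2 p.2 : nat).
  apply: computable_rat_lt.
    have := computable_rat_subst (morphism_pair (morphism_id oracles G3) cprec3) cu.
    by congr (computable_rat _); apply/funext => -[[y b] x].
  apply: computable_rat_add.
    apply: (computable_rat_subst (G := ext base) (s := fun p : G3 => (p.1.1.1, prec p.1.1))) custar.
    by apply: morphism_pair cprec3; exact: (morphism_comp f2 (morphism_fst _ _)).
  by apply: computable_rat_mul; [apply/computable_rat_natr/computable_const | exact: computable_rat_invS].
have uP' (y : ext base) b x : `|rnorm (coset_vector y.1 b x) - ratr (u (y, b, x) (prec y))| <=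
    (prec y).+1%:R^-1 by exact: (uP (y, b, x)).
have exP (y : ext base) : exists b x, test y b x.
  set d := y.1; set eta : R := (prec y).+1%:R^-1.
  have eta0 : 0 < eta by rewrite invr_gt0 ltr0n.
  have eta2 : 0 < eta / 2 by lra.
  have eta4 : 0 < eta / 4 by lra.
  have [h hP] := coset_approaches ip_norm (@operator_nonexpansive d) (element d) eta2.
  have [b [x bx]] := code_vector_dense e_basis h eta4.
  exists b, x; rewrite /test -(ltr_rat R) rmorphD rmorphM /= ratr_nat ratr_invS -/eta.
  have := uP' y b x; rewrite ler_norml -/eta -/d => /andP[H1 H2].
  have := ustarP d (prec y); rewrite ler_norml -/eta -/(rnorm (fstar d)) => /andP[H3 H4].
  have := rnorm_coboundary (@operator_nonexpansive d) (h - code_vector e b x).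
  have := rnormD (element d - coboundary (operator d) h)
    (coboundary (operator d) (h - code_vector e b x)).
  have -> : element d - coboundary (operator d) h +
      coboundary (operator d) (h - code_vector e b x) = coset_vector d b x.
    have -> : coboundary (operator d) h = coboundary (operator d) (h - code_vector e b x) +
        coboundary (operator d) (code_vector e b x) by rewrite -coboundaryD subrK.
    rewrite /coset_vector; set r := coboundary _ (h - code_vector e b x); set s := coboundary _ _.
    move: r s => r s; by rewrite opprD addrA addrAC subrK.
  move: hP; rewrite -/(fstar d); lra.
have [b [x [cb' cx' bxP]]] := computable_search2 (P := test) ctest exP.
exists b, x; split=> // y; have := bxP y; set d := y.1; set eta : R := (prec y).+1%:R^-1.
rewrite /test -(ltr_rat R) rmorphD rmorphM /= ratr_nat ratr_invS -/eta -/d => tst.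
have := uP' y (b y) (x y); rewrite ler_norml -/eta -/d => /andP[H1 H2].
have := ustarP d (prec y); rewrite ler_norml -/eta -/(rnorm (fstar d)) => /andP[H3 H4].
apply: (coset_norm_bound (M := (M d)%:R) (eta := eta)) => //.
- exact: rnorm_ge0.
- exact: rnorm_ge0.
- by rewrite invr_gt0 ltr0n.
- by rewrite invf_le1 ?ltr0n // ler1n.
- exact: precE.
- lra.
Qed.

Lemma computable_limit : computable_vector (G := base) fstar.
Proof.
have [b [x [cb cx bxP]]] := computable_coset_search.
apply: (computable_vector_limit (G := base) (w := fun d m => coset_vector d (b (d, m)) (x (d, m)))).
  have := computable_coset_vector cb cx; congr (computable_vector _).
  by apply/funext => -[].
move=> d m; apply: (limit_near ip_norm (@operator_nonexpansive d)); last by rewrite invr_ge0 ler0n.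
exact: (bxP (d, m)).
Qed.

(** With [d = 1 / (4 (j + 1))] and [m >= 8 (j + 1) |h|] both terms of
    [average_stable] are at most [1 / (4 (j + 1))], so that two averages differ by
    at most [1 / (j + 1)]. *)
Lemma computable_rate : exists2 F : carrier (ext base) -> nat, computable F &
  forall d, (forall j, 0 < F (d, j))%N /\ (forall j m, (F (d, j) <= m)%N ->
    rnorm (ergodic_average (operator d) (element d) m -
        ergodic_average (operator d) (element d) (F (d, j))) <= j.+1%:R^-1).
Proof.
have [b [x [cb cx bxP]]] := computable_coset_search.
have [u cu uP] := computable_vector_norm e_norm (computable_code_vector cb cx).
have [W [cW WP]] := computable_rat_bound (computable_rat_subst
  (morphism_pair (morphism_id oracles (ext base)) (computable_const _ _ 0)) cu).
have hW y : rnorm (code_vector e (b y) (x y)) <= (W y).+1%:R.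
  have := uP y 0%N; have := WP y; rewrite /= -(ler_rat R) ratr_norm ratr_nat.
  rewrite invr1 -natr1 => H1 H2.
  have := ler_norm (rnorm (code_vector e (b y) (x y)) - ratr (u y 0)).
  have := ler_norm (ratr (u y 0) : R); lra.
pose K j := (4 * j).+3.
pose F (y : ext base) := (8 * y.2.+1 * (W (y.1, K y.2)).+1).+1.
exists F.
  apply: computable_succ; apply: computable_mul.
    by apply: computable_mul; [exact: computable_const | apply: computable_succ; exact: computable_head].
  apply: computable_succ; apply: (computable_subst (s := fun y : ext base => (y.1, K y.2) : ext base)) cW.
  apply: morphism_pair; first exact: morphism_fst.
  do 3!apply: computable_succ; apply: computable_mul; [exact: computable_const | exact: computable_head].
move=> d; split=> // j.
set f := element d; set T := operator d.
pose g := coset_vector d (b (d, K j)) (x (d, K j)).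
suff near m : (F (d, j) <= m)%N -> rnorm (ergodic_average T f m - g) <= j.+1%:R^-1 / 2.
  move=> m Fm; have := near m Fm; have := near _ (leqnn (F (d, j))).
  have := rnorm_tri g (ergodic_average T f m) (ergodic_average T f (F (d, j))).
  rewrite (rnorm_distC g); move: (j.+1%:R^-1) => ?; lra.
move=> Fm; have m0 : (0 < m)%N by exact: leq_trans Fm.
have := average_stable ip_norm (@operator_nonexpansive d) (bxP (d, K j)) _ m0.
rewrite invr_ge0 ler0n => /(_ isT) /le_trans; apply.
have -> : (K j).+1%:R^-1 = j.+1%:R^-1 / 4 :> R.
  rewrite /K (_ : (4 * j).+4 = (4 * j.+1)%N); last by lia.
  by rewrite natrM; field; rewrite nat1r pnatr_eq0.
set h := code_vector _ _ _.
suff : 2 * rnorm h / m%:R <= j.+1%:R^-1 / 4 by move: (_ / m%:R) (j.+1%:R^-1) => ? ?; lra.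
rewrite ler_pdivrMr ?ltr0n //.
apply: (@le_trans _ _ (2 * (W (d, K j)).+1%:R)); first by rewrite ler_wpM2l // (hW (d, K j)).
apply: (@le_trans _ _ (j.+1%:R^-1 / 4 * (8 * j.+1 * (W (d, K j)).+1)%:R)).
  rewrite !natrM le_eqVlt; apply/orP; left; apply/eqP; field.
  by rewrite nat1r pnatr_eq0.
by rewrite ler_wpM2l ?divr_ge0 ?invr_ge0 // ler_nat; exact: ltnW.
Qed.

End Algorithm.

Theorem theorem5p2 (R : realType) (k : scalar_kind)
    (H : completeNormedModType (scalars R k)) (ip : {dot H for @conj_scalar R k})
    (e : nat -> H) :
  induces_norm ip -> is_basis e ->
  computable_inner_product e ip -> computable_norm e ->
  exists Plim Prate : program,
    forall (T : {linear H -> H}) (f : H),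
      nonexpansive T ->
      let fstar : H := limn (ergodic_average T f) in
      forall phif phiT phinorm : name,
        names_vector e f phif ->
        names_operator e T phiT ->
        names_real `|fstar| phinorm ->
        computes_some Plim [:: phif; phiT; phinorm] (names_vector e fstar) /\
        computes_some Prate [:: phif; phiT; phinorm]
          (names_rate (ergodic_average T f)).
Proof.
move=> ip_norm e_basis _ e_norm.
have [phi iphi phiP] := implemented_vector_name (computable_limit ip_norm e_basis e_norm).
have [Plim PlimP] := implemented_program iphi.
have [F cF FP] := computable_rate ip_norm e_basis e_norm.
have irate := implemented_rate cF.
have [Prate PrateP] := implemented_program irate.
exists Plim, Prate => T f T1 fstar phif phiT phinorm fP TP normP.
pose d := Problem T1 fP TP normP.
split; first by exists (phi d); split; [exact: (PlimP d) | exact: (phiP d)].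
exists (fun q => F (d, ((nth 0 q 1).+1 %/ (nth 0 q 0).+1)%N)); split; first exact: (PrateP d).
have [F0 Fnear] := FP d.
by apply: (names_rate_intro (F := fun j => F (d, j))).
Qed.
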